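(* Let $P_{X^\ast}$ be the capacity-achieving input distribution of the binomial channel with $n$ trials and $P_{Y^\ast}$ its induced output distribution, and let $P_{Y_r}$ be the Beta-binomial output distribution defined below. Then: (i) With the absolute constant $c_\star:=\frac{1}{4e\,3^{7/4}\pi^{7/4}}$, for every $n\ge1$ and every $y\in\{0,\dots,n\}$, \[ \frac{P_{Y_r}(y)}{P_{Y^\ast}(y)}\ge c_\star. \] (ii) For every $n\ge 444$, \[ D(P_{Y_r}\,\|\,P_{Y^\ast})\le \frac{17}{\log\!\left(\frac{n\pi}{2e}\right)}. \]
   Context: All logarithms are natural. For an integer $n\ge1$, the binomial channel has input $X\in[0,1]$, output $Y\in\{0,\dots,n\}$ and transition law $P_{Y|X}(y|x)=\binom{n}{y}x^y(1-x)^{n-y}$. Its capacity is $C(n)=\max_{P_X} I(X;Y)$ over probability distributions $P_X$ on $[0,1]$; the maximizer $P_{X^\ast}$ (the capacity-achieving input distribution) is unique, and $P_{Y^\ast}$ denotes the output distribution it induces. The reference input is $X_r\sim\mathrm{Beta}(1/2,1/2)$, with density $f_{X_r}(x)=\frac{1}{\pi\sqrt{x(1-x)}}$ on $(0,1)$; its induced output is the Beta-binomial pmf \[ P_{Y_r}(y)=\frac{\Gamma(y+\tfrac12)\Gamma(n-y+\tfrac12)}{\pi\,\Gamma(y+1)\Gamma(n-y+1)},\qquad y=0,\dots,n. \] $D(P\|Q)=\sum_y P(y)\log\frac{P(y)}{Q(y)}$ denotes relative entropy. *)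

(* Defs.v *)
From mathcomp Require Import all_boot all_algebra all_classical all_reals all_analysis.
Import GRing.Theory Num.Theory.
Local Open Scope ring_scope.
Local Open Scope classical_set_scope.

Section Binomial.
Variable R : realType.

Definition binW (n y : nat) (x : R) : R :=
  'C(n, y)%:R * x ^+ y * (1 - x) ^+ (n - y).

Definition input_dist (P : probability R R) : Prop :=
  P `[0%R, 1%R] = 1%E.

Definition out_pmf (n : nat) (P : probability R R) (y : nat) : R :=
  Rintegral P `[0%R, 1%R] (binW n y).

(* mutual information I(X;Y) = E_P[ sum_y W(y|X) log (W(y|X) / P_Y(y)) ]
   (terms with W(y|x) = 0 contribute 0) *)
Definition mutual_info (n : nat) (P : probability R R) : R :=
  Rintegral P `[0%R, 1%R]
    (fun x => \sum_(y < n.+1) binW n y x * ln (binW n y x / out_pmf n P y)).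

Definition capacity_achieving (n : nat) (P : probability R R) : Prop :=
  input_dist P /\
  forall Q : probability R R, input_dist Q -> mutual_info n Q <= mutual_info n P.

Definition Gammaf (s : R) : R :=
  Rintegral (@lebesgue_measure R) `]0%R, +oo[ (fun t => t `^ (s - 1) * expR (- t)).

(* Beta-binomial pmf induced by X_r ~ Beta(1/2,1/2) *)
Definition PYr (n y : nat) : R :=
  Gammaf (y%:R + 2^-1) * Gammaf ((n - y)%:R + 2^-1) /
  (pi * Gammaf (y%:R + 1) * Gammaf ((n - y)%:R + 1)).

Definition rel_entropy (n : nat) (p q : nat -> R) : R :=
  \sum_(y < n.+1) p y * ln (p y / q y).

Definition cstar : R :=
  1 / (4 * expR 1 * 3 `^ (7 / 4) * pi `^ (7 / 4)).

End Binomial.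

Arguments binW {R}.
Arguments out_pmf {R}.
Arguments mutual_info {R}.
Arguments capacity_achieving {R}.
Arguments PYr {R}.
Arguments rel_entropy {R}.

(* Main.v *)
Require Import Defs.
From mathcomp Require Import all_boot all_order all_algebra all_classical all_reals all_analysis.
From mathcomp Require Import measurable_realfun ring lra.
Import Order.TTheory GRing.Theory Num.Theory.
Import numFieldNormedType.Exports.
Set Implicit Arguments.
Unset Strict Implicit.
Unset Printing Implicit Defensive.
Local Open Scope classical_set_scope.
Local Open Scope ring_scope.

(** Let q be the optimal output pmf, C the capacity, d the binary relative
    entropy, and call x tight when D(W_x || q) = C. The KKT conditions
    (perturb P* towards a Dirac mass) give D(W_x || q) <= C on [0, 1] and
    P*-almost every x is tight.

    For a tight x, Jensen's inequality against W_x turns D(W_x || q) = C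
    into E exp(- n d(x || X)) <= exp(- C). Split E exp(- n d(y/n || X)) at p
    = y/n: X <= p is almost surely below the last tight x <= p, where d(p ||
    X) >= d(x || X); symmetrically for X >= p. Hence q(y) <= 2 exp(- C)
    W_{y/n}(y), with no gap estimate on the support.

    Stirling-type monotonicity gives P_{Y_r}(y) = W_{y/n}(y) exp(- A -
    rho(y)) with A depending only on n and 0 <= rho(y) <= 1, so D(W_x ||
    P_{Y_r}) = A - psi(x) + E_x rho with psi(x) = E_x [n d(Y/n || x)] in [0,
    1]. Averaging D(W_x || q) <= C over the arcsine law yields C >= A - 1,
    hence (i). Averaging over the arcsine law and over P* and comparing
    bounds D(P_{Y_r} || q) by the difference of the two means of psi plus
    the q-mean of rho. This is at most 2; and since psi = 1/2 + O(E_x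
    [1/(Y+1) + 1/(n-Y+1)]) and q <= 2 e^2 P_{Y_r}, it is also O(n^{-1/2}),
    which implies (ii). *)

(** * Logarithm estimates *)

Section bounds_on_ln.
Variable R : realType.
Implicit Types x u : R.

(** The sign condition places c and x on the same side of 1, so the sign arguments for Taylor
    remainders at 1 treat x < 1 and x > 1 together. *)
Lemma MVT_from1 (g g' : R -> R) :
  (forall x, 0 < x -> is_derive x 1 g (g' x)) ->
  forall x, 0 < x ->
  exists2 c, 0 < c /\ 0 <= (c - 1) * (x - 1) & g x - g 1 = g' c * (x - 1).
Proof.
move=> dg x x0.
have cg a b : 0 < a -> {within `[a, b], continuous g}.
  move=> a0; apply: derivable_within_continuous => z; rewrite in_itv/= => /andP[az _].
  by have [] := dg z (lt_le_trans a0 az).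
have [x1|x1] := leP 1 x.
- have [|c|c] := @MVT_segment _ g g' _ _ x1.
  + move=> z; rewrite in_itv/= => /andP[z1 _].
    exact: dg (lt_trans ltr01 z1).
  + exact: cg.
  + rewrite in_itv/= => /andP[c1 cx] E; exists c => //.
    by split; [lra|nra].
- have [|c|c] := @MVT_segment _ g g' _ _ (ltW x1).
  + move=> z; rewrite in_itv/= => /andP[z1 _].
    exact: dg (lt_trans x0 z1).
  + exact: cg.
  + rewrite in_itv/= => /andP[c1 cx] E; exists c => //.
      by split; [lra|nra].
    by rewrite -opprB E; ring.
Qed.

Lemma MVT_ln_sub_poly (p : {poly R}) x : 0 < x ->
  exists2 c, 0 < c & ln x - p.[x] + p.[1] = (c^-1 - p^`().[c]) * (x - 1)
     /\ 0 <= (c - 1) * (x - 1).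
Proof.
move=> x0; have [|c [c0 cx] E] := @MVT_from1 (@ln R - horner p) (fun z => z^-1 - p^`().[z]) _ x x0.
  by move=> z z0; exact: is_deriveB (is_derive1_ln z0) (is_derive_poly p z).
by exists c => //; split=> //; rewrite -E !fctE ln1; ring.
Qed.

Lemma MVT_xln_sub_poly (p : {poly R}) x : 0 < x ->
  exists2 c, 0 < c & x * ln x - p.[x] + p.[1] = (ln c + 1 - p^`().[c]) * (x - 1)
     /\ 0 <= (c - 1) * (x - 1).
Proof.
move=> x0; have [|c [c0 cx] E] := @MVT_from1 (id * @ln R - horner p)
    (fun z => ln z + 1 - p^`().[z]) _ x x0.
  move=> z z0; apply: is_deriveB (is_derive_poly p z).
  apply: (is_derive_eq (is_deriveM (is_derive_id z 1) (is_derive1_ln z0))).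
  by rewrite /GRing.scale/= mulr1 mulfV ?gt_eqF// addrC.
by exists c => //; split=> //; rewrite -E !fctE ln1; ring.
Qed.

Let X1 : {poly R} := 'X - 1%:P.

(** With u = x - 1, the function ln x - u + u^2/2 vanishes at 1 and has derivative u^2/x >= 0, so it
    has the sign of u. *)
Lemma ln_sub_quadratic_sign x : 0 < x -> 0 <= (x - 1) * (ln x - (x - 1) + (x - 1) ^+ 2 / 2).
Proof.
move=> x0; pose p := X1 - 2^-1 *: X1 ^+ 2.
have pE y : p.[y] = (y - 1) - (y - 1) ^+ 2 / 2 by rewrite /p /X1 !hornerE /=; field.
have p'E y : p^`().[y] = 1 - (y - 1) by rewrite /p /X1 !poly.derivE /= !hornerE /=; field.
have [c c0 []] := MVT_ln_sub_poly p x0.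
rewrite p'E !pE !subrr.
have -> : c^-1 - (1 - (c - 1)) = (c - 1) ^+ 2 / c by field; lra.
set a := (c - 1) ^+ 2 / c => E _.
have a0 : 0 <= a by rewrite /a divr_ge0 ?sqr_ge0 ?ltW.
have -> : ln x - (x - 1) + (x - 1) ^+ 2 / 2 = a * (x - 1) by rewrite -E; field.
by rewrite mulrCA -expr2 mulr_ge0 ?sqr_ge0.
Qed.

(** The difference of the two sides has as derivative the function of [ln_sub_quadratic_sign], so it
    is minimal at 1, where it vanishes. *)
Lemma xlnx_ge_cubic x : 0 <= x ->
  (x - 1) + (x - 1) ^+ 2 / 2 - (x - 1) ^+ 3 / 6 <= x * ln x.
Proof.
rewrite le_eqVlt => /predU1P[<-|x0]; first by rewrite mul0r; lra.
pose p := X1 + 2^-1 *: X1 ^+ 2 - 6^-1 *: X1 ^+ 3.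
have pE y : p.[y] = (y - 1) + (y - 1) ^+ 2 / 2 - (y - 1) ^+ 3 / 6 by rewrite /p /X1 !hornerE /=; field.
have p'E y : p^`().[y] = 1 + (y - 1) - (y - 1) ^+ 2 / 2 by rewrite /p /X1 !poly.derivE /= !hornerE /=; field.
have [c c0 []] := MVT_xln_sub_poly p x0.
rewrite p'E !pE !subrr => E cx.
rewrite -subr_ge0.
have {E} -> : x * ln x - (x - 1 + (x - 1) ^+ 2 / 2 - (x - 1) ^+ 3 / 6) =
   (ln c - (c - 1) + (c - 1) ^+ 2 / 2) * (x - 1).
  rewrite -[RHS](_ : (ln c + 1 - (1 + (c - 1) - (c - 1) ^+ 2 / 2)) * (x - 1) = _); last by field.
  by rewrite -E; field.
have := ln_sub_quadratic_sign c0; set q := (ln c - _ + _) => qc.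
have [c1|c1|c1] := ltgtP c 1.
- rewrite nmulr_rge0 ?subr_lt0// in qc; rewrite nmulr_rge0 ?subr_lt0// in cx.
  by rewrite mulr_le0.
- rewrite pmulr_rge0 ?subr_gt0// in qc; rewrite pmulr_rge0 ?subr_gt0// in cx.
  by rewrite mulr_ge0.
- by rewrite /q c1 ln1 !subrr expr0n/= !mul0r addr0 mul0r.
Qed.

(** With u = x - 1, the right side minus the left side has derivative u^3/x, hence its minimum 0 at
    u = 0. *)
Lemma ln_le_cubic x : 0 < x -> ln x <= (x - 1) - (x - 1) ^+ 2 / 2 + (x - 1) ^+ 3 / 3.
Proof.
move=> x0; pose p := X1 - 2^-1 *: X1 ^+ 2 + 3^-1 *: X1 ^+ 3.
have pE y : p.[y] = (y - 1) - (y - 1) ^+ 2 / 2 + (y - 1) ^+ 3 / 3 by rewrite /p /X1 !hornerE /=; field.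
have p'E y : p^`().[y] = 1 - (y - 1) + (y - 1) ^+ 2 by rewrite /p /X1 !poly.derivE /= !hornerE /=; field.
have [c c0 []] := MVT_ln_sub_poly p x0.
rewrite p'E !pE !subrr => E cx.
rewrite -subr_ge0.
have -> : (x - 1) - (x - 1) ^+ 2 / 2 + (x - 1) ^+ 3 / 3 - ln x =
    (c - 1) ^+ 2 / c * ((c - 1) * (x - 1)).
  rewrite -[RHS](_ : - ((c^-1 - (1 - (c - 1) + (c - 1) ^+ 2)) * (x - 1)) = _); last by field; lra.
  by rewrite -E; field.
by rewrite mulr_ge0// divr_ge0 ?sqr_ge0//; exact: ltW.
Qed.

Lemma xlnx_le_quartic x : 0 <= x ->
  x * ln x <= (x - 1) + (x - 1) ^+ 2 / 2 - (x - 1) ^+ 3 / 6 + (x - 1) ^+ 4 / 3.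
Proof.
rewrite le_eqVlt => /predU1P[<-|x0]; first by rewrite mul0r; lra.
(* With u = x - 1, the product (1 + u)(u - u^2/2 + u^3/3) is exactly the required quartic. *)
have := ler_wpM2l (ltW x0) (ln_le_cubic x0); move/le_trans; apply.
by rewrite le_eqVlt; apply/orP; left; apply/eqP; field.
Qed.

Lemma ln_le_sub1 x : 0 < x -> ln x <= x - 1.
Proof. by move=> x0; rewrite -[X in ln X](subrKC 1) le_ln1Dx//; lra. Qed.

Lemma xlnx_ge_sub1 x : 0 <= x -> x - 1 <= x * ln x.
Proof.
rewrite le_eqVlt => /predU1P[<-|x0]; first by rewrite mul0r; lra.
have xV : 0 < x^-1 by rewrite invr_gt0.
have := ln_le_sub1 xV; rewrite lnV ?posrE// => h.
have : x * - ln x <= x * (x^-1 - 1) by rewrite ler_wpM2l// ltW.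
by rewrite mulrBr divff ?gt_eqF// mulr1 mulrN; lra.
Qed.

Lemma xlnx_le_quadratic x : 0 <= x -> x * ln x <= (x - 1) + (x - 1) ^+ 2.
Proof.
rewrite le_eqVlt => /predU1P[<-|x0]; first by rewrite mul0r; lra.
have := ler_wpM2l (ltW x0) (ln_le_sub1 x0); move/le_trans; apply.
by rewrite le_eqVlt; apply/orP; left; apply/eqP; ring.
Qed.

End bounds_on_ln.

(** * Binomial expectations *)

Section binomial_mean.
Variable R : realType.
Implicit Types (x u : R) (n y : nat) (f g : nat -> R).

Definition Ebin n x f : R := \sum_(y < n.+1) binW n y x * f y.

Lemma binW_ge0 n y x : 0 <= x <= 1 -> 0 <= binW n y x.
Proof.
by case/andP=> x0 x1; rewrite /binW !mulr_ge0// exprn_ge0// subr_ge0.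
Qed.

Lemma Ebin_eq n x f g : (forall y, (y <= n)%N -> f y = g y) ->
  Ebin n x f = Ebin n x g.
Proof. by move=> fg; apply: eq_bigr => y _; rewrite fg// -ltnS. Qed.

Lemma Ebin_le n x f g : 0 <= x <= 1 -> (forall y, (y <= n)%N -> f y <= g y) ->
  Ebin n x f <= Ebin n x g.
Proof.
move=> x01 fg; apply: ler_sum => y _.
by rewrite ler_wpM2l ?binW_ge0// fg// -ltnS.
Qed.

Lemma EbinD n x f g : Ebin n x (fun y => f y + g y) = Ebin n x f + Ebin n x g.
Proof. by rewrite -big_split/=; apply: eq_bigr => y _; rewrite mulrDr. Qed.

Lemma EbinZ n x c f : Ebin n x (fun y => c * f y) = c * Ebin n x f.
Proof. by rewrite mulr_sumr; apply: eq_bigr => y _; rewrite mulrCA. Qed.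

Lemma binW_succ n y x :
  binW n.+1 y.+1 x = x * binW n y x + (1 - x) * binW n y.+1 x.
Proof.
rewrite /binW binS natrD subSS exprS.
have [yn|yn] := ltnP y n.
  rewrite -[in (n - y)%N](subnSK yn) [in _ ^+ (n - y.+1).+1]exprS; ring.
by rewrite bin_small//; ring.
Qed.

Lemma binW_succ0 n x : binW n.+1 0 x = (1 - x) * binW n 0 x.
Proof. by rewrite /binW !bin0 !subn0 !expr0 !mul1r exprS. Qed.

(** Condition on one trial: a failure keeps the count, a success raises it by one. *)
Lemma Ebin_succ n x f :
  Ebin n.+1 x f = (1 - x) * Ebin n x f + x * Ebin n x (fun y => f y.+1).
Proof.
rewrite /Ebin big_ord_recl/= binW_succ0.
under eq_bigr do rewrite /bump/= add1n binW_succ mulrDl.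
rewrite big_split/= addrCA addrC; congr (_ + _).
  have b0 : binW n n.+1 x = 0 by rewrite /binW bin_small// !mul0r.
  rewrite big_ord_recr/= b0 mulr0 mul0r addr0.
  rewrite [in RHS]big_ord_recl/= mulrDr mulr_sumr; congr (_ + _).
    by rewrite /binW; ring.
  by apply: eq_bigr => i _; rewrite -[LHS]mulrA.
by rewrite mulr_sumr; apply: eq_bigr => i _; rewrite -[LHS]mulrA.
Qed.

Lemma Ebin1 n x : Ebin n x (fun=> 1) = 1.
Proof.
elim: n => [|n IH]; last by rewrite Ebin_succ IH; ring.
by rewrite /Ebin big_ord1/= /binW bin0 !expr0 !mulr1.
Qed.

Lemma Ebin_cst n x c : Ebin n x (fun=> c) = c.
Proof. by rewrite -[RHS]mulr1 -(Ebin1 n x) -EbinZ; apply: Ebin_eq => y; rewrite mulr1. Qed.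

Let Z n x y : R := y%:R - n%:R * x.

(** This packages the central moments up to order four. Arbitrary coefficients close the induction:
    one more trial shifts [Z] by -x or 1 - x, which gives another quartic in [Z]. *)
Lemma Ebin_poly n x a0 a1 a2 a3 a4 :
  Ebin n x (fun y => a0 + a1 * Z n x y + a2 * Z n x y ^+ 2 + a3 * Z n x y ^+ 3
                     + a4 * Z n x y ^+ 4) =
  a0 + a2 * (n%:R * x * (1 - x)) + a3 * (n%:R * x * (1 - x) * (1 - 2 * x))
  + a4 * (3 * (n%:R * x * (1 - x)) ^+ 2 + n%:R * x * (1 - x) * (1 - 6 * x * (1 - x))).
Proof.
elim: n a0 a1 a2 a3 a4 => [|n IH] a0 a1 a2 a3 a4.
  by rewrite /Ebin big_ord1/= /binW/Z bin0 !expr0 !mulr1; ring.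
rewrite Ebin_succ.
have -> : Ebin n x (fun y => a0 + a1 * Z n.+1 x y + a2 * Z n.+1 x y ^+ 2 + a3 * Z n.+1 x y ^+ 3
                     + a4 * Z n.+1 x y ^+ 4) =
  Ebin n x (fun y => (a0 - a1 * x + a2 * x ^+ 2 - a3 * x ^+ 3 + a4 * x ^+ 4)
    + (a1 - 2 * a2 * x + 3 * a3 * x ^+ 2 - 4 * a4 * x ^+ 3) * Z n x y
    + (a2 - 3 * a3 * x + 6 * a4 * x ^+ 2) * Z n x y ^+ 2
    + (a3 - 4 * a4 * x) * Z n x y ^+ 3 + a4 * Z n x y ^+ 4).
  by apply: Ebin_eq => y _; rewrite /Z -natr1; ring.
pose b := 1 - x.
have -> : Ebin n x (fun y => a0 + a1 * Z n.+1 x y.+1 + a2 * Z n.+1 x y.+1 ^+ 2 + a3 * Z n.+1 x y.+1 ^+ 3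
                     + a4 * Z n.+1 x y.+1 ^+ 4) =
  Ebin n x (fun y => (a0 + a1 * b + a2 * b ^+ 2 + a3 * b ^+ 3 + a4 * b ^+ 4)
    + (a1 + 2 * a2 * b + 3 * a3 * b ^+ 2 + 4 * a4 * b ^+ 3) * Z n x y
    + (a2 + 3 * a3 * b + 6 * a4 * b ^+ 2) * Z n x y ^+ 2
    + (a3 + 4 * a4 * b) * Z n x y ^+ 3 + a4 * Z n x y ^+ 4).
  by apply: Ebin_eq => y _; rewrite /Z /b -!natr1; ring.
by rewrite !IH /b -natr1; ring.
Qed.

Lemma Ebin_id n x : Ebin n x (fun y => y%:R) = n%:R * x.
Proof.
rewrite -[RHS]addr0 -[X in _ = _ + X](_ : Ebin n x (fun y => 0 + 1 * Z n x y + 0 * Z n x y ^+ 2 + 0 * Z n x y ^+ 3 + 0 * Z n x y ^+ 4) = 0); last first.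
  by rewrite Ebin_poly; ring.
rewrite -[X in _ = X + _](Ebin_cst n x) -EbinD; apply: Ebin_eq => y _.
by rewrite /Z; ring.
Qed.

Lemma Ebin_rev n x f : Ebin n (1 - x) f = Ebin n x (fun y => f (n - y)%N).
Proof.
rewrite /Ebin [LHS](reindex_inj rev_ord_inj)/=; apply: eq_bigr => y _.
rewrite subSS /binW bin_sub -1?ltnS//; have yn : (y <= n)%N by rewrite -ltnS.
by rewrite subKn// subKr; ring.
Qed.

(** Jensen's inequality for the convex function 1/(1 + y), through its tangent line at the mean
    m. *)
Lemma Ebin_inv_ge n x : 0 <= x <= 1 ->
  (1 + n%:R * x)^-1 <= Ebin n x (fun y => y.+1%:R^-1).
Proof.
move=> x01; set m := n%:R * x.
have m0 : 0 <= m by rewrite mulr_ge0//; case/andP: x01.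
have <- : Ebin n x (fun y => (1 + m)^-1 + (1 + m) ^- 2 * m + (- (1 + m) ^- 2) * y%:R) = (1 + m)^-1.
  by rewrite EbinD Ebin_cst EbinZ Ebin_id -/m; ring.
apply: Ebin_le => // y _; rewrite -subr_ge0.
rewrite -natr1.
have y0 : 0 <= y%:R :> R by [].
have -> : (y%:R + 1)^-1 - ((1 + m)^-1 + (1 + m) ^- 2 * m + - (1 + m) ^- 2 * y%:R) =
  (y%:R - m) ^+ 2 * ((1 + m) ^- 2 / (y%:R + 1)).
  by field; rewrite !gt_eqF//; lra.
by rewrite mulr_ge0 ?sqr_ge0// divr_ge0 ?invr_ge0 ?sqr_ge0//; lra.
Qed.

Definition Hbin n x : R := n%:R * (x * ln x + (1 - x) * ln (1 - x)).

(* psi n x = E_x [n d(Y/n || x)], the linear part of the divergence having mean zero. *)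
Definition psi n x : R := Ebin n x (fun y => Hbin n (y%:R / n%:R)) - Hbin n x.

Lemma Hbin_rev n x : Hbin n (1 - x) = Hbin n x.
Proof. by rewrite /Hbin subKr addrC. Qed.

Lemma Hbin0 n : Hbin n 0 = 0.
Proof. by rewrite /Hbin mul0r subr0 ln1 mulr0 addr0 mulr0. Qed.

Lemma Hbin1 n : Hbin n 1 = 0.
Proof. by rewrite -(subr0 1) Hbin_rev Hbin0. Qed.

Lemma Ebin0 n f : Ebin n 0 f = f 0%N.
Proof.
rewrite /Ebin big_ord_recl/= big1 => [|i _].
  by rewrite /binW bin0 subr0 expr0 expr1n !mul1r addr0.
by rewrite /binW/bump/= add1n exprS !(mul0r, mulr0).
Qed.

Lemma Ebin_at1 n f : Ebin n 1 f = f n.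
Proof. by rewrite -(subr0 1) Ebin_rev Ebin0 subn0. Qed.

Lemma psi0 n : psi n 0 = 0.
Proof. by rewrite /psi Ebin0 mul0r Hbin0 subr0. Qed.

Lemma psi1 n : (0 < n)%N -> psi n 1 = 0.
Proof. by move=> n0; rewrite /psi Ebin_at1 divff ?pnatr_eq0 -?lt0n// Hbin1 subr0. Qed.

Let xi u := u * ln u.

(** Subtracting the log-likelihood, linear in y and of mean [Hbin n x], leaves t ln t at the
    relative counts Y/(nx) and (n - Y)/(n(1 - x)). Polynomial bounds on t ln t around t = 1 thereby
    become bounds on [psi]. *)
Lemma psiE n x : (0 < n)%N -> 0 < x < 1 ->
  psi n x = Ebin n x (fun y => n%:R * x * xi (y%:R / (n%:R * x))
    + n%:R * (1 - x) * xi ((n - y)%:R / (n%:R * (1 - x)))).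
Proof.
move=> n0 /andP[x0 x1].
have n0' : 0 < n%:R :> R by rewrite ltr0n.
have x1' : 0 < 1 - x by rewrite subr_gt0.
have -> : psi n x = Ebin n x (fun y => Hbin n (y%:R / n%:R) -
   (y%:R * ln x + (n%:R - y%:R) * ln (1 - x))).
  rewrite (@Ebin_eq _ _ _ (fun y => Hbin n (y%:R / n%:R) + (- (n%:R * ln (1 - x)) +
    (ln (1 - x) - ln x) * y%:R))); last by move=> y _; ring.
  by rewrite EbinD EbinD EbinZ Ebin_cst Ebin_id /psi /Hbin; ring.
apply: Ebin_eq => y yn.
rewrite natrB//.
have H (a b : R) (c : R) : 0 <= a -> 0 < b -> 0 < c ->
   a * ln (a / c) - a * ln b = (c * b) * xi (a / (c * b)).
  rewrite le_eqVlt => /predU1P[<- _ _|a0 b0 c0]; first by rewrite /xi !mul0r mulr0 subr0.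
  have -> : a / (c * b) = a / c / b by rewrite invfM mulrA.
  rewrite /xi [ln (a / c / b)]ln_div ?posrE ?divr_gt0//; field.
  by rewrite !gt_eqF.
rewrite -!H ?subr_ge0 ?ler_nat// /Hbin.
have -> : 1 - y%:R / n%:R = (n%:R - y%:R) / n%:R :> R by field; rewrite gt_eqF.
by field; rewrite gt_eqF.
Qed.

(** The coefficient of v is fixed to 1: in [Ebin_P] the two linear terms are opposite and cancel, so
    only central moments of orders 2 to 4 remain. *)
Let P (a2 a3 a4 v : R) := v + a2 * v ^+ 2 + a3 * v ^+ 3 + a4 * v ^+ 4.

Lemma Ebin_P n x a2 a3 a4 : (0 < n)%N -> 0 < x < 1 ->
  Ebin n x (fun y => n%:R * x * P a2 a3 a4 (y%:R / (n%:R * x) - 1)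
    + n%:R * (1 - x) * P a2 a3 a4 ((n - y)%:R / (n%:R * (1 - x)) - 1)) =
  a2 + a3 * (1 - 2 * x) ^+ 2 / (n%:R * x * (1 - x)) + a4 *
     (3 * (n%:R * x * (1 - x)) ^+ 2 + n%:R * x * (1 - x) * (1 - 6 * x * (1 - x))) *
    ((n%:R * x) ^- 3 + (n%:R * (1 - x)) ^- 3).
Proof.
move=> n0 /andP[x0 x1].
have n0' : 0 < n%:R :> R by rewrite ltr0n.
have x1' : 0 < 1 - x by rewrite subr_gt0.
pose u := n%:R * x; pose w := n%:R * (1 - x).
have u0 : 0 < u by rewrite mulr_gt0.
have w0 : 0 < w by rewrite mulr_gt0.
transitivity (Ebin n x (fun y => 0 + 0 * Z n x y + (a2 * (u^-1 + w^-1)) * Z n x y ^+ 2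
  + (a3 * (u ^- 2 - w ^- 2)) * Z n x y ^+ 3 + (a4 * (u ^- 3 + w ^- 3)) * Z n x y ^+ 4)).
  apply: Ebin_eq => y yn; rewrite natrB// -/u -/w.
  have -> : y%:R / u - 1 = Z n x y / u by rewrite /Z -/u; field; rewrite gt_eqF.
  have -> : (n%:R - y%:R) / w - 1 = - Z n x y / w.
    by rewrite /Z /w; field; rewrite !gt_eqF.
  by rewrite /P; field; rewrite !gt_eqF.
rewrite Ebin_poly -/u /w /u; field.
by rewrite !gt_eqF.
Qed.

Lemma psi_le n x a2 a3 a4 : (0 < n)%N -> 0 < x < 1 ->
  (forall t, 0 <= t -> xi t <= P a2 a3 a4 (t - 1)) ->
  psi n x <= a2 + a3 * (1 - 2 * x) ^+ 2 / (n%:R * x * (1 - x)) + a4 *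
     (3 * (n%:R * x * (1 - x)) ^+ 2 + n%:R * x * (1 - x) * (1 - 6 * x * (1 - x))) *
    ((n%:R * x) ^- 3 + (n%:R * (1 - x)) ^- 3).
Proof.
move=> n0 x01 h; rewrite psiE// -Ebin_P//.
have [x0 x1] : 0 < x /\ x < 1 by move/andP: x01.
apply: Ebin_le; first by rewrite !ltW.
move=> y yn.
by apply: lerD; rewrite ler_wpM2l ?h ?divr_ge0 ?mulr_ge0// ?subr_ge0 ltW.
Qed.

Lemma psi_ge n x a2 a3 a4 : (0 < n)%N -> 0 < x < 1 ->
  (forall t, 0 <= t -> P a2 a3 a4 (t - 1) <= xi t) ->
  a2 + a3 * (1 - 2 * x) ^+ 2 / (n%:R * x * (1 - x)) + a4 *
     (3 * (n%:R * x * (1 - x)) ^+ 2 + n%:R * x * (1 - x) * (1 - 6 * x * (1 - x))) *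
    ((n%:R * x) ^- 3 + (n%:R * (1 - x)) ^- 3) <= psi n x.
Proof.
move=> n0 x01 h; rewrite psiE// -Ebin_P//.
have [x0 x1] : 0 < x /\ x < 1 by move/andP: x01.
apply: Ebin_le; first by rewrite !ltW.
move=> y yn.
by apply: lerD; rewrite ler_wpM2l ?h ?divr_ge0 ?mulr_ge0// ?subr_ge0 ltW.
Qed.

Lemma itv01_cases x : 0 <= x <= 1 -> [\/ x = 0, x = 1 | 0 < x < 1].
Proof.
case/andP; rewrite le_eqVlt => /predU1P[<-|x0]; first by constructor.
rewrite le_eqVlt => /predU1P[->|x1]; first by constructor 2.
by constructor 3; rewrite x0.
Qed.

Lemma psi_ge0 n x : (0 < n)%N -> 0 <= x <= 1 -> 0 <= psi n x.
Proof.
move=> n0 /itv01_cases[->|->|x01]; rewrite ?psi0 ?psi1//.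
apply: le_trans (@psi_ge n x 0 0 0 n0 x01 _); first by rewrite !mul0r !addr0.
by move=> t t0; apply: le_trans (xlnx_ge_sub1 t0); rewrite /P; lra.
Qed.

(** Relative entropy is at most chi-squared divergence, and the chi-squared statistic here has mean
    exactly 1. *)
Lemma psi_le1 n x : (0 < n)%N -> 0 <= x <= 1 -> psi n x <= 1.
Proof.
move=> n0 /itv01_cases[->|->|x01]; rewrite ?psi0 ?psi1//.
apply: le_trans (@psi_le n x 1 0 0 n0 x01 _) _; last by rewrite !mul0r !addr0.
by move=> t t0; apply: le_trans (xlnx_le_quadratic t0) _; rewrite /P; lra.
Qed.

(** The error scale of [psi] around 1/2, of order 1/(nx) + 1/(n(1 - x)) in the bulk and bounded at
    the endpoints. As an expectation over Y, it averages over an input law to a sum against the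
    output pmf. *)
Definition Tbin n x := Ebin n x (fun y => y.+1%:R^-1 + (n - y).+1%:R^-1).

Lemma Tbin_ge n x : 0 <= x <= 1 ->
  (1 + n%:R * x)^-1 + (1 + n%:R * (1 - x))^-1 <= Tbin n x.
Proof.
move=> x01; rewrite /Tbin EbinD -(Ebin_rev n x (fun y => y.+1%:R^-1)).
by apply: lerD; apply: Ebin_inv_ge => //; case/andP: x01 => x0 x1; apply/andP; split; lra.
Qed.

(** In the bulk the quartic bound on t ln t gives 1/2 plus inverse powers of nx and n(1 - x). Near
    an endpoint [Tbin] is so large that [psi_le1] suffices. *)
Lemma psi_le_half n x : (0 < n)%N -> 0 <= x <= 1 ->
  psi n x <= 2^-1 + 2 * Tbin n x.
Proof.
move=> n0 x01; have := Tbin_ge n x01.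
have n0' : 0 < n%:R :> R by rewrite ltr0n.
have := psi_le1 n0 x01.
set u := n%:R * x; set w := n%:R * (1 - x) => p1 T.
have u0 : 0 <= u by rewrite mulr_ge0//; case/andP: x01.
have w0 : 0 <= w by rewrite mulr_ge0// subr_ge0; case/andP: x01.
have iu : 0 < (1 + u)^-1 by rewrite invr_gt0; lra.
have iw : 0 < (1 + w)^-1 by rewrite invr_gt0; lra.
(* For u <= 3 one has 2/(1 + u) >= 1/2, so the right side is at least 1. *)
have [u3|u3] := leP u 3.
  have : 4^-1 <= (1 + u)^-1 by rewrite lef_pV2 ?posrE//; lra.
  lra.
have [w3|w3] := leP w 3.
  have : 4^-1 <= (1 + w)^-1 by rewrite lef_pV2 ?posrE//; lra.
  lra.
have x0 : 0 < x by rewrite -(pmulr_rgt0 _ n0') -/u; lra.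
have x1 : 0 < 1 - x by rewrite -(pmulr_rgt0 _ n0') -/w; lra.
have x01' : 0 < x < 1 by apply/andP; split; lra.
have pos : 0 < n%:R * x * (1 - x) by rewrite !mulr_gt0.
have h : forall t, 0 <= t -> xi t <= P 2^-1 (- 6^-1) 3^-1 (t - 1).
  by move=> t t0; apply: le_trans (xlnx_le_quartic t0) _; rewrite /P; lra.
apply: le_trans (psi_le n0 x01' h) _.
apply: le_trans (_ : 2^-1 + (u^-1 + (3 * u ^+ 2)^-1 + (w^-1 + (3 * w ^+ 2)^-1)) <= _).
  (* The cubic coefficient is negative, so that term is dropped; the quartic term is estimated with
     n x (1 - x) <= min(u, w). *)
  rewrite -addrA lerD2l -[leRHS]add0r lerD//.
    rewrite mulNr mulNr oppr_le0 divr_ge0 ?(ltW pos)// mulr_ge0 ?sqr_ge0//.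
  have key (v z : R) : 0 < v -> 0 <= z -> z <= v ->
     (3 * z ^+ 2 + z * (1 - 6 * x * (1 - x))) / (3 * v ^+ 3) <= v^-1 + (3 * v ^+ 2)^-1.
    move=> v0 z0 zv.
    have -> : v^-1 + (3 * v ^+ 2)^-1 = (3 * v ^+ 2 + v) / (3 * v ^+ 3).
      by field; rewrite gt_eqF.
    rewrite ler_wpM2r ?invr_ge0 ?mulr_ge0 ?exprn_ge0 ?(ltW v0)//.
    have z2 : z ^+ 2 <= v ^+ 2 by rewrite lerXn2r ?nnegrE// ltW.
    have : 0 <= z * (6 * x * (1 - x)) by rewrite !mulr_ge0 ?(ltW x0) ?(ltW x1).
    by lra.
  set q := n%:R * x * (1 - x); rewrite -/u -/w.
  have qu : q <= u by rewrite /q -/u ler_piMr//; lra.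
  have qw : q <= w by rewrite /q mulrAC -/w ler_piMr//; lra.
  rewrite [leLHS](_ : _ = (3 * q ^+ 2 + q * (1 - 6 * x * (1 - x))) / (3 * u ^+ 3) +
    (3 * q ^+ 2 + q * (1 - 6 * x * (1 - x))) / (3 * w ^+ 3)); last first.
    by field; rewrite !gt_eqF//; lra.
  by apply: lerD; apply: key; rewrite ?(ltW pos)//; lra.
have key (v : R) : 3 < v -> v^-1 + (3 * v ^+ 2)^-1 <= 2 * (1 + v)^-1.
  move=> v3; rewrite -subr_ge0.
  have -> : 2 * (1 + v)^-1 - (v^-1 + (3 * v ^+ 2)^-1) =
    (3 * v ^+ 2 - 4 * v - 1) / (3 * v ^+ 2 * (1 + v)).
    by field; rewrite !gt_eqF//; lra.
  by rewrite divr_ge0 ?mulr_ge0 ?sqr_ge0//; nra.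
have := key _ u3; have := key _ w3; lra.
Qed.

(** The cubic bound loses at most 1/(6 n x (1 - x)) = 1/(6u) + 1/(6w). If u or w is at most 1/3,
    then 2/3 [Tbin] >= 2/3 * 3/4 = 1/2 and [psi_ge0] suffices. *)
Lemma psi_ge_half n x : (0 < n)%N -> 0 <= x <= 1 ->
  2^-1 - 2 / 3 * Tbin n x <= psi n x.
Proof.
move=> n0 x01; have := Tbin_ge n x01.
have n0' : 0 < n%:R :> R by rewrite ltr0n.
have := psi_ge0 n0 x01.
set u := n%:R * x; set w := n%:R * (1 - x) => p1 T.
have u0 : 0 <= u by rewrite mulr_ge0//; case/andP: x01.
have w0 : 0 <= w by rewrite mulr_ge0// subr_ge0; case/andP: x01.
have iu : 0 < (1 + u)^-1 by rewrite invr_gt0; lra.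
have iw : 0 < (1 + w)^-1 by rewrite invr_gt0; lra.
have [u3|u3] := leP u (3^-1).
  have : (4 / 3)^-1 <= (1 + u)^-1 by rewrite lef_pV2 ?posrE//; lra.
  lra.
have [w3|w3] := leP w (3^-1).
  have : (4 / 3)^-1 <= (1 + w)^-1 by rewrite lef_pV2 ?posrE//; lra.
  lra.
have x0 : 0 < x by rewrite -(pmulr_rgt0 _ n0') -/u; lra.
have x1 : 0 < 1 - x by rewrite -(pmulr_rgt0 _ n0') -/w; lra.
have x01' : 0 < x < 1 by apply/andP; split; lra.
have pos : 0 < n%:R * x * (1 - x) by rewrite !mulr_gt0.
have h : forall t, 0 <= t -> P 2^-1 (- 6^-1) 0 (t - 1) <= xi t.
  by move=> t t0; apply: le_trans (xlnx_ge_cubic t0); rewrite /P; lra.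
apply: le_trans (psi_ge n0 x01' h).
rewrite !mul0r addr0.
apply: le_trans (_ : 2^-1 - (6 * u)^-1 - (6 * w)^-1 <= _).
  have key (v : R) : 3^-1 < v -> (6 * v)^-1 <= 2 / 3 * (1 + v)^-1.
    move=> v3; rewrite -subr_ge0.
    have -> : 2 / 3 * (1 + v)^-1 - (6 * v)^-1 = (3 * v - 1) / (6 * v * (1 + v)).
      by field; rewrite !gt_eqF//; lra.
    by rewrite divr_ge0 ?mulr_ge0//; lra.
  have := key _ u3; have := key _ w3; lra.
rewrite -addrA lerD2l -opprD mulNr mulNr lerN2.
have -> : (6 * u)^-1 + (6 * w)^-1 = 6^-1 / (n%:R * x * (1 - x)).
  by rewrite /u /w; field; rewrite !gt_eqF.
rewrite ler_wpM2r ?invr_ge0 ?(ltW pos)//.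
have : 0 <= x * (1 - x) by rewrite mulr_ge0// ltW.
by nra.
Qed.

End binomial_mean.

(** * The reference pmf *)

Section stirling.
Variable R : realType.
Implicit Types (x u : R) (n y : nat).

(* wallis y = Gamma(y + 1/2) / (sqrt pi * y!). *)
Definition wallis y : R := \prod_(k < y) ((2 * k%:R + 1) / (2 * k%:R + 2)).

Lemma wallisS y : wallis y.+1 = wallis y * ((2 * y%:R + 1) / (2 * y%:R + 2)).
Proof. by rewrite /wallis big_ord_recr. Qed.

Lemma wallis0 : wallis 0 = 1. Proof. by rewrite /wallis big_ord0. Qed.

Lemma wallis_gt0 y : 0 < wallis y.
Proof.
elim: y => [|y IH]; first by rewrite wallis0.
by rewrite wallisS mulr_gt0// divr_gt0// ltr_wpDl.
Qed.

(** The induction step amounts to (2y + 1)(2y + 3) <= (2y + 2)^2. *)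
Lemma wallis_sq_le y : wallis y ^+ 2 <= (2 * y%:R + 1)^-1.
Proof.
elim: y => [|y IH]; first by rewrite wallis0 expr1n mulr0 add0r invr1.
have y0 : 0 <= y%:R :> R by [].
rewrite wallisS exprMn; apply: le_trans (ler_wpM2r (sqr_ge0 _) IH) _.
rewrite -natr1 -subr_ge0.
rewrite [leRHS](_ : _ = ((2 * (y%:R + 1) + 1) * (2 * y%:R + 2) ^+ 2)^-1); last first.
  by field; rewrite !gt_eqF//; lra.
by rewrite invr_ge0 mulr_ge0 ?sqr_ge0//; lra.
Qed.

(* lstir y = ln (Gamma(y + 1/2) e^y / (sqrt pi y^y)); it increases, to (ln 2)/2. *)
Definition lstir y : R := ln (wallis y) + ln y`!%:R + y%:R - y%:R * ln y%:R.

(** Here y + 1 = (y + 1/2)(1 + w) and y = (y + 1/2)(1 - w). Centring at the midpoint makes the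
    bracket odd in w, which cancels the even orders of its expansion. *)
Lemma lstir_step y : let w := (2 * y%:R + 1)^-1 in
  lstir y.+1 - lstir y =
  (2 * w)^-1 * (2 * w - ((1 + w) * ln (1 + w) - (1 - w) * ln (1 - w))).
Proof.
move=> w; have y0 : 0 <= y%:R :> R by [].
have h0 : 0 < y%:R + 2^-1 :> R by lra.
have E1 : (1 + w) * ln (1 + w) = (1 + w) * (ln (y%:R + 1) - ln (y%:R + 2^-1)).
  congr (_ * _); rewrite -ln_div ?posrE//.
  by congr ln; rewrite /w; field; rewrite !gt_eqF//; lra.
have E2 : (1 - w) * ln (1 - w) = (1 - w) * (ln y%:R - ln (y%:R + 2^-1)).
  move: y0; rewrite le_eqVlt => /predU1P[yE|y0].
    by rewrite /w -yE mulr0 add0r invr1 subrr !mul0r.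
  congr (_ * _); rewrite -ln_div ?posrE//.
  by congr ln; rewrite /w; field; rewrite !gt_eqF//; lra.
rewrite E1 E2 /lstir wallisS factS natrM.
rewrite (lnM (wallis_gt0 _)) ?posrE; last by rewrite divr_gt0 ?ltr_wpDl.
rewrite [ln (y.+1%:R * _)]lnM ?posrE ?ltr0n ?fact_gt0//.
have -> : (2 * y%:R + 1) / (2 * y%:R + 2) = (y%:R + 2^-1) / (y%:R + 1) :> R.
  by field; rewrite !gt_eqF//; lra.
rewrite ln_div ?posrE// ?ltr_wpDl// -[y.+1%:R]natr1 /w; field; rewrite !gt_eqF//; lra.
Qed.

(** A cubic bound at one of 1 + w, 1 - w paired with a quartic bound at the other puts the bracket
    between (w^3 - w^4)/3 and (w^3 + w^4)/3. The upper bound is stated as a difference so that it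
    telescopes. *)
Lemma lstir_step_bounds y :
  0 <= lstir y.+1 - lstir y <= (2 * (2 * y%:R + 1))^-1 - (2 * (2 * y.+1%:R + 1))^-1.
Proof.
rewrite lstir_step; set w := (2 * y%:R + 1)^-1.
have y0 : 0 <= y%:R :> R by [].
have w0 : 0 < w by rewrite invr_gt0; lra.
have w1 : w <= 1 by rewrite invf_le1; lra.
have wp : 0 <= 1 + w by lra.
have wm : 0 <= 1 - w by lra.
have := xlnx_ge_cubic wp; have := xlnx_le_quartic wp; have := xlnx_ge_cubic wm; have := xlnx_le_quartic wm.
have -> : 1 + w - 1 = w by ring.
have -> : 1 - w - 1 = - w by ring.
move=> h1 h2 h3 h4.
have w4 : w ^+ 4 <= w ^+ 3 by rewrite [w ^+ 4]exprS ler_piMl// exprn_ge0// ltW.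
apply/andP; split; first by rewrite mulr_ge0 ?invr_ge0 ?mulr_ge0// ?(ltW w0)//; lra.
apply: le_trans (_ : (2 * w)^-1 * (w ^+ 3 / 3 + w ^+ 4 / 3) <= _).
  by rewrite ler_wpM2l ?invr_ge0 ?mulr_ge0 ?(ltW w0)//; lra.
rewrite -subr_ge0 -[y.+1%:R]natr1 /w.
rewrite [leRHS](_ : _ = (20 * y%:R ^+ 2 + 14 * y%:R) / (6 * (2 * y%:R + 3) * (2 * y%:R + 1) ^+ 3)); last first.
  by field; rewrite !gt_eqF//; lra.
by rewrite divr_ge0 ?mulr_ge0 ?exprn_ge0 ?addr_ge0 ?mulr_ge0 ?sqr_ge0.
Qed.

Definition rstir n y := lstir n - lstir y.

Lemma rstir_bounds n y : (y <= n)%N ->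
  0 <= rstir n y <= (2 * (2 * y%:R + 1))^-1.
Proof.
move=> yn; suff : 0 <= rstir n y <= (2 * (2 * y%:R + 1))^-1 - (2 * (2 * n%:R + 1))^-1.
  case/andP=> -> /= /le_trans; apply.
  by rewrite gerBl invr_ge0 mulr_ge0// addr_ge0.
rewrite -(subnK yn); move: (n - y)%N => {n yn}; elim=> [|k IH].
  by rewrite add0n /rstir !subrr lexx.
have := lstir_step_bounds (k + y); move: IH; rewrite /rstir addSn.
by move=> /andP[a b] /andP[c d]; apply/andP; split; lra.
Qed.

Lemma rstir_le_inv n y : (y <= n)%N -> rstir n y <= 2^-1 * y.+1%:R^-1.
Proof.
move=> yn; have /andP[_ /le_trans] := rstir_bounds yn; apply.
have y0 : 0 <= y%:R :> R by [].
rewrite invfM ler_wpM2l// lef_pV2 ?posrE ?ltr0n// -?[y.+1%:R]natr1; lra.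
Qed.

Lemma rstir_le_half n y : (y <= n)%N -> rstir n y <= 2^-1.
Proof.
move=> yn; apply: le_trans (rstir_le_inv yn) _.
by rewrite ler_piMr// invf_le1 ?ltr0n// ler1n.
Qed.

(* Absorbs all y-independent Stirling factors; the value at the endpoint n replaces the limit of lstir. *)
Definition Astir n : R := ln n`!%:R + n%:R - n%:R * ln n%:R - 2 * lstir n.

Definition Yref n y : R := wallis y * wallis (n - y).

Lemma Yref_gt0 n y : 0 < Yref n y.
Proof. by rewrite mulr_gt0 ?wallis_gt0. Qed.

Lemma Yref_rev n y : (y <= n)%N -> Yref n (n - y) = Yref n y.
Proof. by move=> yn; rewrite /Yref subKn// mulrC. Qed.

Lemma Hbin_frac n y : (0 < n)%N -> (y <= n)%N ->
  Hbin n (y%:R / n%:R : R) = y%:R * ln y%:R + (n - y)%:R * ln (n - y)%:R - n%:R * ln n%:R.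
Proof.
move=> n0 yn.
have n0' : 0 < n%:R :> R by rewrite ltr0n.
have H k : n%:R * (k%:R / n%:R * ln (k%:R / n%:R)) = k%:R * ln k%:R - k%:R * ln n%:R :> R.
  have [->|k0] := posnP k; first by rewrite !mul0r subrr mulr0.
  rewrite ln_div ?posrE ?ltr0n//; field; rewrite gt_eqF//.
have -> : Hbin n (y%:R / n%:R : R) = n%:R * (y%:R / n%:R * ln (y%:R / n%:R)) +
   n%:R * ((n - y)%:R / n%:R * ln ((n - y)%:R / n%:R)).
  rewrite /Hbin -mulrDr natrB//.
  by have -> : 1 - y%:R / n%:R = (n%:R - y%:R) / n%:R :> R by field; rewrite gt_eqF.
by rewrite !H natrB//; ring.
Qed.

(** An identity rather than an asymptotic estimate: the whole y-dependent Stirling error sits in the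
    two [rstir] terms. *)
Lemma ln_Yref n y : (0 < n)%N -> (y <= n)%N ->
  ln (Yref n y / 'C(n, y)%:R) =
  Hbin n (y%:R / n%:R) - Astir n - rstir n y - rstir n (n - y).
Proof.
move=> n0 yn; rewrite Hbin_frac//.
have Cgt0 : 0 < 'C(n, y)%:R :> R by rewrite ltr0n bin_gt0.
have f0 k : 0 < k`!%:R :> R by rewrite ltr0n fact_gt0.
have EC : ln 'C(n, y)%:R = ln n`!%:R - ln y`!%:R - ln (n - y)`!%:R :> R.
  by rewrite -(bin_fact yn) !natrM !lnM ?posrE ?mulr_gt0//; ring.
rewrite ln_div ?posrE ?Yref_gt0// EC /Yref (lnM (wallis_gt0 _) (wallis_gt0 _)).
by rewrite /Astir /rstir /lstir natrB//; ring.
Qed.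

(** Since wallis y / (y + 1) = 2 (wallis y - wallis (y + 1)), the sum is twice the difference
    between the mass at n and the mass at n + 1 without its term y = 0. The total mass 1 comes
    later, from the arcsine moments. *)
Lemma Yref_sum_inv n : (forall m, \sum_(y < m.+1) Yref m y = 1) ->
  \sum_(y < n.+1) Yref n y * y.+1%:R^-1 = 2 * wallis n.+1.
Proof.
move=> S.
have E y : wallis y * y.+1%:R^-1 = 2 * (wallis y - wallis y.+1).
  rewrite wallisS -[y.+1%:R]natr1; have y0 : 0 <= y%:R :> R by [].
  by field; rewrite !gt_eqF//; lra.
under eq_bigr do rewrite /Yref mulrAC E -mulrA mulrBl.
rewrite -mulr_sumr big_split/= sumrN (S n); congr (_ * _).
have := S n.+1; rewrite big_ord_recl/= /Yref wallis0 mul1r subn0.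
by under eq_bigr do rewrite /bump/= add1n subSS; lra.
Qed.

Lemma Yref_sum_inv2 n : (forall m, \sum_(y < m.+1) Yref m y = 1) ->
  \sum_(y < n.+1) Yref n y * (y.+1%:R^-1 + (n - y).+1%:R^-1) = 4 * wallis n.+1.
Proof.
move=> S; under eq_bigr do rewrite mulrDr.
rewrite big_split/= Yref_sum_inv//.
rewrite [X in _ + X](_ : _ = 2 * wallis n.+1); first by lra.
rewrite -Yref_sum_inv// [RHS](reindex_inj rev_ord_inj)/=.
by apply: eq_bigr => y _; rewrite subSS Yref_rev// -ltnS.
Qed.

End stirling.

(** * The Gamma function at integers and half-integers *)

Section gamma.
Variable R : realType.
Implicit Types (x u s t : R) (n y k : nat).
Let mu := @lebesgue_measure R.

(** Monotone convergence along compact intervals inside ]0, +oo[, on which integration by parts and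
    substitution apply. *)
Lemma cvg_integral_exhaust (a b : R^nat) (f : R -> R) :
  (forall k, 0 < a k) -> nonincreasing_seq a -> nondecreasing_seq b ->
  a @ \oo --> 0 -> b @ \oo --> +oo ->
  {in `]0, +oo[, continuous f} -> (forall x, 0 < x -> 0 <= f x) ->
  (\int[mu]_(x in `[a k, b k]) (f x)%:E)%E @[k --> \oo] -->
  (\int[mu]_(x in `]0%R, +oo[) (f x)%:E)%E.
Proof.
move=> a0 da ib al bl cf f0.
have -> : `]0%R, +oo[%classic = \bigcup_k `[a k, b k]%classic :> set R.
  apply/seteqP; split => x /=.
    rewrite in_itv/= andbT => x0.
    have [k _ kx] : \forall k \near \oo, a k <= x /\ x <= b k.
      have h1 : \forall k \near \oo, a k < x by exact: (cvgr_lt 0).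
      have h2 : \forall k \near \oo, x <= b k by move/cvgryPge : bl; apply.
      by near=> k; split; [apply: ltW|]; near: k.
    by exists k => //=; rewrite in_itv/=; apply/andP; apply: kx => /=.
  by case=> k _ /=; rewrite !in_itv/= andbT => /andP[ak _]; exact: lt_le_trans ak.
apply: ge0_nondecreasing_set_cvg_integral => //.
- apply/nondecreasing_seqP => k; rewrite subsetEset; apply: subset_itv.
    by rewrite bnd_simp; exact: da.
  by rewrite bnd_simp; exact: ib.
- move=> k; apply/measurable_EFinP.
  apply: subspace_continuous_measurable_fun => //.
  apply: continuous_in_subspaceT => x; rewrite inE/= in_itv/= => /andP[ak _].
  by apply: cf; rewrite in_itv/= andbT (lt_le_trans (a0 k)).
- by move=> k x /=; rewrite in_itv/= => /andP[ak _]; rewrite lee_fin f0// (lt_le_trans _ ak).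
Unshelve. all: by end_near. Qed.

Definition gamma_fun s t := t `^ (s - 1) * expR (- t).

Lemma gamma_fun_ge0 s t : 0 <= gamma_fun s t.
Proof. by rewrite mulr_ge0 ?powR_ge0 ?expR_ge0. Qed.

Lemma powR_continuous_gt0 s t : 0 < t -> {for t, continuous (fun t => t `^ s)}.
Proof.
move=> t0; apply/differentiable_continuous/derivable1_diffP.
by apply: derivable_powR; rewrite in_itv/= t0.
Qed.

Lemma expRN_continuous t : {for t, continuous (fun t => expR (- t))}.
Proof. by apply: continuous_comp; [exact: opp_continuous|exact: continuous_expR]. Qed.

Lemma gamma_fun_continuous s : {in `]0, +oo[, continuous (gamma_fun s)}.
Proof.
move=> t; rewrite in_itv/= andbT => t0; apply: (@cvgM _ _ (nbhs t) _ (fun t => t `^ (s - 1)) (fun t => expR (- t))).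
  exact: powR_continuous_gt0.
exact: expRN_continuous.
Qed.

Let I s := (\int[mu]_(t in `]0%R, +oo[) (gamma_fun s t)%:E)%E.

Let hk k : R := k.+1%:R.
Let ak k : R := k.+1%:R^-1.

Let ak0 k : 0 < ak k. Proof. by rewrite invr_gt0 ltr0n. Qed.

Let ak_noninc : nonincreasing_seq ak.
Proof. by move=> m n mn; rewrite /ak lef_pV2 ?posrE ?ltr0n// ler_nat ltnS. Qed.

Let hk_nondec : nondecreasing_seq hk.
Proof. by move=> m n mn; rewrite ler_nat ltnS. Qed.

Let ak_cvg : ak @ \oo --> 0. Proof. exact: cvg_harmonic. Qed.

Let hk_cvg : hk @ \oo --> +oo.
Proof. by have h := @cvgr_idn R; rewrite -cvg_shiftS in h. Qed.

Let I_cvg s : (\int[mu]_(t in `[ak k, hk k]) (gamma_fun s t)%:E)%E @[k --> \oo] --> I s.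
Proof.
apply: cvg_integral_exhaust => //; first exact: gamma_fun_continuous.
by move=> *; exact: gamma_fun_ge0.
Qed.


(** Boundary term of the integration by parts that differentiates t^s and integrates exp(-t). *)
Let bnd s t := t `^ s * expR (- t).

Let within_cont (f : R -> R) (a b : R) : 0 < a -> {in `]0, +oo[, continuous f} ->
  {within `[a, b], continuous f}.
Proof.
move=> a0 cf; apply: continuous_in_subspaceT => x; rewrite inE/= in_itv/= => /andP[ax _].
by apply: cf; rewrite in_itv/= andbT (lt_le_trans a0).
Qed.

Let integ (f : R -> R) (a b : R) : 0 < a -> {in `]0, +oo[, continuous f} ->
  mu.-integrable `[a, b] (EFin \o f).
Proof.
move=> a0 cf; apply: continuous_compact_integrable; first exact: segment_compact.
exact: within_cont.
Qed.

Let LR (f : R -> R) (a b : R) : 0 < a -> a < b -> {in `]0, +oo[, forall x, derivable f x 1} ->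
  derivable_oo_LRcontinuous f a b.
Proof.
move=> a0 ab df.
have cf x : 0 < x -> {for x, continuous f}.
  move=> x0; apply/differentiable_continuous/derivable1_diffP.
  by apply: df; rewrite in_itv/= x0.
split.
- by move=> x; rewrite in_itv/= => /andP[ax _]; apply: df; rewrite in_itv/= andbT (lt_trans a0).
- exact/cvg_at_right_filter/cf.
- by apply/cvg_at_left_filter/cf; exact: lt_trans ab.
Qed.

Let is_derive_G x : is_derive x 1 (fun t => - expR (- t)) (expR (- x)).
Proof.
have := @is_deriveN _ _ _ (@expR R \o -%R) x 1 _
  (is_derive1_comp (is_derive_expR (- x)) (is_deriveNid x 1)).
by rewrite mulrN1 opprK.
Qed.

Let by_parts s (a b : R) : 0 < a -> a < b ->
  (\int[mu]_(t in `[a, b]) (gamma_fun (s + 1) t)%:E =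
  (bnd s a - bnd s b)%:E + s%:E * \int[mu]_(t in `[a, b]) (gamma_fun s t)%:E)%E.
Proof.
move=> a0 ab.

have dpow : {in `]0, +oo[, forall x, is_derive x 1 (fun t => t `^ s) (s * x `^ (s - 1))}.
  by move=> x; rewrite in_itv/= andbT => x0; exact: is_derive1_powR.
have cpow p : {in `]0, +oo[, continuous (fun t => t `^ p)}.
  by move=> x; rewrite in_itv/= andbT => x0; exact: powR_continuous_gt0.
have cspow : {in `]0, +oo[, continuous (fun t => s * t `^ (s - 1))}.
  by move=> x x0; apply: cvgM; [exact: cvg_cst|exact: cpow].
have H1 : {within `[a, b], continuous (fun t => s * t `^ (s - 1))} by exact: within_cont.
have H2 : derivable_oo_LRcontinuous (fun t => t `^ s) a b.
  by apply: LR => // x x0; have [] := dpow x x0.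
have H3 : {in `]a, b[, (fun t => t `^ s)^`()%classic =1 (fun t => s * t `^ (s - 1))}.
  move=> x; rewrite in_itv/= => /andP[ax _]; have x0 := lt_trans a0 ax.
  by rewrite derive1E; have [] := dpow x _; rewrite ?in_itv/= ?x0.
have H4 : {within `[a, b], continuous (fun t => expR (- t))}.
  by apply: within_cont => // x _; exact: expRN_continuous.
have H5 : derivable_oo_LRcontinuous (fun t => - expR (- t)) a b.
  by apply: LR => // x _; have [] := is_derive_G x.
have H6 : {in `]a, b[, (fun t => - expR (- t))^`()%classic =1 (fun t => expR (- t))}.
  by move=> x _; rewrite derive1E; have [] := is_derive_G x.
rewrite (_ : (\int[mu]_(t in `[a, b]) (gamma_fun (s + 1) t)%:E)%E =
  (\int[mu]_(x in `[a, b]) (x `^ s * expR (- x))%:E)%E); last first.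
  by apply: eq_integral => x _; rewrite /gamma_fun addrK.
rewrite (integration_by_parts ab H1 H2 H3 H4 H5 H6).
rewrite (_ : (\int[mu]_(x in `[a, b]) (s * x `^ (s - 1) * - expR (- x))%:E)%E =
   ((- s)%:E * \int[mu]_(t in `[a, b]) (gamma_fun s t)%:E)%E); last first.
  rewrite -integralZl//; last exact: integ (@gamma_fun_continuous s).
  by apply: eq_integral => x _; rewrite -EFinM /gamma_fun; congr _%:E; ring.
rewrite EFinN mulNe oppeK; congr (_%:E + _)%E.
by rewrite /bnd; ring.
Qed.

Let cvg_bnd_b m s : s <= m%:R -> bnd s (hk k) @[k --> \oo] --> 0.
Proof.
move=> sm.
apply: (@squeeze_cvgr _ _ _ _ (cst 0) (fun k => m.+1`!%:R * ak k)) => //.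
- near=> k.
  have h1 : 1 <= hk k by rewrite ler1n.
  have h0 : 0 < hk k by rewrite (lt_le_trans ltr01).
  rewrite /bnd mulr_ge0 ?powR_ge0 ?expR_ge0//= expRN ler_pdivrMr ?expR_gt0//.
  apply: le_trans (ler_powR h1 sm) _; rewrite powR_mulrn ?(ltW h0)//.
  have f0 : 0 < m.+1`!%:R :> R by rewrite ltr0n fact_gt0.
  have := expR_ge1Dxn m (ltW h0) => e.
  apply: le_trans (_ : m.+1`!%:R * ak k * (hk k ^+ m.+1 / m.+1`!%:R) <= _).
    rewrite /ak -/(hk k) exprS.
    rewrite [leRHS](_ : _ = hk k ^+ m)//; field; rewrite !gt_eqF//.
  by rewrite ler_wpM2l ?mulr_ge0 ?(ltW f0) ?(ltW (ak0 k))//; lra.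
- exact: cvg_cst.
- by rewrite -[X in _ --> X](mulr0 m.+1`!%:R); apply: cvgM; [exact: cvg_cst|exact: ak_cvg].
Unshelve. all: by end_near. Qed.

Let cvg_bnd_a s : 0 < s -> bnd s (ak k) @[k --> \oo] --> 0.
Proof.
move=> s0.
apply: (@squeeze_cvgr _ _ _ _ (cst 0) (fun k => ak k `^ s)) => //.
- near=> k.
  rewrite /bnd mulr_ge0 ?powR_ge0 ?expR_ge0//= ler_piMr ?powR_ge0//.
  by rewrite -expR0 ler_expR oppr_le0 ltW.
- exact: cvg_cst.
- apply: cvg_comp (powR_cvg0 s0).
  move=> A [e /= e0 Ae]; have : \forall k \near \oo, ak k < e by exact: (cvgr_lt 0).
  apply: filterS => k ke; apply: Ae => //=.
  by rewrite sub0r normrN gtr0_norm.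
Unshelve. all: by end_near. Qed.

(* m only serves to dominate t^s by a polynomial at infinity. *)
Lemma integral_gamma_succ m s : 0 < s -> s <= m%:R ->
  (\int[mu]_(t in `]0%R, +oo[) (gamma_fun (s + 1) t)%:E =
   s%:E * \int[mu]_(t in `]0%R, +oo[) (gamma_fun s t)%:E)%E.
Proof.
move=> s0 sm; rewrite -[RHS]add0e; apply: (cvg_unique _ (@I_cvg (s + 1))) => //.
apply: (@cvg_trans _ (((bnd s (ak k) - bnd s (hk k))%:E + s%:E * \int[mu]_(t in `[ak k, hk k]) (gamma_fun s t)%:E)%E @[k --> \oo])).
  apply: near_eq_cvg; near=> k; rewrite by_parts//.
  apply: (@lt_trans _ _ 1); first by rewrite invf_lt1 ?ltr0n// ltr1n ltnS; near: k; exact: nbhs_infty_gt.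
  by rewrite ltr1n ltnS; near: k; exact: nbhs_infty_gt.
apply: cvgeD => //.
  apply: cvg_EFin; first exact: nearW.
  rewrite -[X in _ --> X](subr0 0); apply: cvgB; [exact: cvg_bnd_a|exact: cvg_bnd_b sm].
by apply: cvgeZl => //; exact: I_cvg.
Unshelve. all: by end_near. Qed.

Lemma Gammaf_succ m s : 0 < s -> s <= m%:R -> Gammaf R (s + 1) = s * Gammaf R s.
Proof.
move=> s0 sm; rewrite /Gammaf /Rintegral.
have := integral_gamma_succ s0 sm; rewrite /gamma_fun => ->.
set J := (\int[_]_(_ in _) _)%E.
have : (0 <= J)%E by apply: integral_ge0 => x _; rewrite lee_fin; exact: gamma_fun_ge0.
(* An infinite integral stays infinite after multiplication by s > 0, and [fine] sends it to 0 on
   both sides. *)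
by case: J => [r| |]//= _; rewrite gt0_muley ?lte_fin//= mulr0.
Qed.


Lemma Gammaf1 : Gammaf R 1 = 1.
Proof.
rewrite /Gammaf /Rintegral.
have -> : (\int[mu]_(t in `]0%R, +oo[) (t `^ (1 - 1) * expR (- t))%:E = 1)%E; last by [].
transitivity (\int[mu]_(t in `]0%R, +oo[) (expR (- t))%:E)%E.
  by apply: eq_integral => t _; rewrite subrr powRr0 mul1r.
rewrite integral_itv_obnd_cbnd; last first.
  apply/measurable_EFinP; apply: open_continuous_measurable_fun => //.
  by move=> t _; exact: expRN_continuous.
rewrite (@ge0_continuous_FTC2y _ _ (fun t => - expR (- t)) 0 0) => //.
- by rewrite oppr0 expR0 sub0e EFinN oppeK.
- by apply: continuous_subspaceT => t; exact: (@expRN_continuous t).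
- by rewrite -[X in _ --> X]oppr0; apply: cvgN; exact: cvgr_expR.
- by apply: cvg_at_right_filter; apply: cvgN; exact: (@expRN_continuous 0).
- by move=> t _; rewrite derive1E; have [] := is_derive_G t.
Qed.

(** The substitution t = u^2 turns the integral into twice the Gaussian integral over the
    half-line. *)
Lemma Gammaf_half : Gammaf R 2^-1 = Num.sqrt pi.
Proof.
rewrite /Gammaf /Rintegral.
suff -> : (\int[mu]_(t in `]0%R, +oo[) (t `^ (2^-1 - 1) * expR (- t))%:E = (Num.sqrt pi)%:E)%E by [].
(* Squared endpoints make the k-th interval the image under u -> u^2 of the one used for the
   Gaussian. *)
pose a2 k := ak k ^+ 2; pose h2 k := hk k ^+ 2.
have c1 : (\int[mu]_(t in `[a2 k, h2 k]) (gamma_fun 2^-1 t)%:E)%E @[k --> \oo] -->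
    (\int[mu]_(t in `]0%R, +oo[) (gamma_fun 2^-1 t)%:E)%E.
  apply: cvg_integral_exhaust => //.
  - by move=> k; rewrite exprn_gt0.
  - by move=> m n mn; rewrite lerXn2r ?nnegrE ?(ltW (ak0 _))//; exact: ak_noninc.
  - by move=> m n mn; rewrite lerXn2r ?nnegrE//; exact: hk_nondec.
  - by rewrite -[X in _ --> X](mulr0 0) /a2; apply: cvgM; exact: ak_cvg.
  - apply: ger_cvgy hk_cvg; near=> k.
    by rewrite /h2 expr2 ler_peMr// ler1n.
  - exact: gamma_fun_continuous.
  - by move=> *; exact: gamma_fun_ge0.
have c2 : (\int[mu]_(t in `[ak k, hk k]) (2 * gauss_fun t)%:E)%E @[k --> \oo] -->
    (\int[mu]_(t in `]0%R, +oo[) (2 * gauss_fun t)%:E)%E.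
  apply: cvg_integral_exhaust => //.
  - move=> t _; apply: cvgM; [exact: cvg_cst|exact: continuous_gauss_fun].
  - by move=> *; rewrite mulr_ge0// gauss_fun_ge0.
transitivity (\int[mu]_(t in `]0%R, +oo[) (2 * gauss_fun t)%:E)%E; last first.
  rewrite integral_itv_obnd_cbnd; last first.
    apply/measurable_EFinP; apply: open_continuous_measurable_fun => //.
    by move=> t _; apply: cvgM; [exact: cvg_cst|exact: continuous_gauss_fun].
  under eq_integral do rewrite EFinM.
  rewrite ge0_integralZl//.
  - by rewrite integral0y_gauss -EFinM mulrCA divff// mulr1.
  - by apply/measurable_EFinP/measurable_funTS; exact: measurable_gauss_fun.
  - by move=> t _; rewrite lee_fin gauss_fun_ge0.
apply: (cvg_unique _ c1) => //; apply: cvg_trans c2; apply: near_eq_cvg; near=> k.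
have akhk : ak k <= hk k.
  by rewrite (@le_trans _ _ 1)// ?invf_le1 ?ltr0n// ler1n.
have sq_d (x : R) : is_derive x 1 (fun t : R => t ^+ 2) (2 * x).
  apply: (is_derive_eq (is_deriveX 2 (is_derive_id x (1:R)))).
  by rewrite /GRing.scale/= mulr1 expr1.
have sqE : (fun t : R => t ^+ 2)^`()%classic = (fun t => 2 * t).
  by apply/funext => x; rewrite derive1E; have [] := sq_d x.
have sq_c (x : R) : {for x, continuous (fun t : R => t ^+ 2)}.
  apply/differentiable_continuous/derivable1_diffP; by have [] := sq_d x.
have l_c (x : R) : {for x, continuous (fun t : R => 2 * t)}.
  by apply: cvgM; [exact: cvg_cst|exact: cvg_id].
rewrite (@integration_by_substitution_increasing _ (fun t => t ^+ 2) (gamma_fun 2^-1) _ _ akhk) ?sqE.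
- apply: eq_integral => t; rewrite inE/= in_itv/= => /andP[at0 _].
  have t0 : 0 < t by exact: lt_le_trans at0.
  congr _%:E; rewrite fctE/= /gamma_fun/gauss_fun.
  have -> : (2^-1 - 1 : R) = - 2^-1 by field.
  rewrite powRN -powR_mulrn ?(ltW t0)// -powRrM mulfV// powRr1 ?(ltW t0)//.
  by field; rewrite gt_eqF.
- move=> x y; rewrite !in_itv/= => /andP[ax _] /andP[ay _] xy.
  by rewrite ltrXn2r// ?nnegrE ?(le_trans (ltW (ak0 k))).
- by move=> x _; exact: l_c.
- by apply: cvgP; apply: cvg_at_right_filter; exact: l_c.
- by apply: cvgP; apply: cvg_at_left_filter; exact: l_c.
- split.
  + by move=> x _; have [] := sq_d x.
  + exact/cvg_at_right_filter/sq_c.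
  + exact/cvg_at_left_filter/sq_c.
- apply: within_cont; first by rewrite exprn_gt0.
  exact: gamma_fun_continuous.
Unshelve. all: by end_near. Qed.

Lemma Gammaf_nat k : Gammaf R (k%:R + 1) = k`!%:R.
Proof.
elim: k => [|k IH]; first by rewrite add0r Gammaf1.
rewrite (@Gammaf_succ k.+1)//.
by rewrite -[k.+1%:R]natr1 IH factS natrM natr1.
Qed.

Lemma Gammaf_nat_half k : Gammaf R (k%:R + 2^-1) = Num.sqrt pi * wallis R k * k`!%:R.
Proof.
elim: k => [|k IH]; first by rewrite add0r Gammaf_half wallis0 !mulr1.
have k0 : 0 <= k%:R :> R by [].
rewrite -[k.+1%:R]natr1 addrAC (@Gammaf_succ k.+1); last 2 first.
  by lra.
  by rewrite -[k.+1%:R]natr1; lra.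
rewrite IH wallisS factS natrM -[k.+1%:R]natr1; field; rewrite gt_eqF//; lra.
Qed.

Lemma PYrE n y : PYr n y = Yref R n y.
Proof.
rewrite /PYr !Gammaf_nat !Gammaf_nat_half /Yref.
have f0 k : k`!%:R != 0 :> R by rewrite pnatr_eq0 -lt0n fact_gt0.
have p0 : Num.sqrt pi != 0 :> R by rewrite gt_eqF// sqrtr_gt0 pi_gt0.
rewrite -[in X in _ / X](sqr_sqrtr (pi_ge0 R)).
by field; rewrite !f0 p0.
Qed.

End gamma.

(** * Means of continuous functions and the arcsine law *)

Section arcsine.
Variable R : realType.
Implicit Types (x u s t : R) (n y k : nat).
Let mu := @lebesgue_measure R.

(** Writing ln x = -2 ln (1/sqrt x) and using ln z <= z - 1 gives a majorant that tends to 0, for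
    continuity of x ln x at 0. *)
Lemma norm_xlnx_le x : `|x| < 1 -> `|x * ln x| <= 2 * Num.sqrt `|x|.
Proof.
move=> x1; have [x0|x0] := leP x 0.
  by rewrite ln0// mulr0 normr0 mulr_ge0// sqrtr_ge0.
rewrite normrM [X in X * _]gtr0_norm// (gtr0_norm x0) in x1 *.
have s0 : 0 < Num.sqrt x by rewrite sqrtr_gt0.
have xE : x = Num.sqrt x ^+ 2 by rewrite sqr_sqrtr// ltW.
have lnx : ln x = - (2 * ln (Num.sqrt x)^-1).
  by rewrite {1}xE lnXn// lnV ?posrE// mulrN opprK mulr_natl.
have l0 : ln x <= 0 by apply: ln_le0; exact: ltW.
rewrite ler0_norm// lnx opprK.
have /ln_le_sub1 h : 0 < (Num.sqrt x)^-1 by rewrite invr_gt0.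
have : x * (2 * ln (Num.sqrt x)^-1) <= x * (2 * ((Num.sqrt x)^-1 - 1)).
  by rewrite ler_wpM2l ?ler_wpM2l// ltW.
move/le_trans; apply.
have -> : x * (2 * ((Num.sqrt x)^-1 - 1)) = 2 * Num.sqrt x - 2 * x.
  have h1 : x / Num.sqrt x = Num.sqrt x by rewrite {1}xE expr2 mulfK// gt_eqF.
  by rewrite -[in RHS]h1; ring.
by rewrite gerBl mulr_ge0// ltW.
Qed.

(* Continuity holds on all of R because ln vanishes on ]-oo, 0]. *)
Lemma xlnx_continuous : continuous (fun x : R => x * ln x).
Proof.
move=> x; have [x0|x0|<-] := ltgtP 0 x.
- by apply: cvgM; [exact: cvg_id|exact: continuous_ln].
- rewrite /continuous_at ln0 ?(ltW x0)// mulr0.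
  have h : (fun=> 0 : R) @ x --> (0 : R) by exact: cvg_cst.
  apply: cvg_trans h; apply: near_eq_cvg; near=> z.
  have z0 : z < 0 by near: z; apply: (cvgr_lt x) => //; exact: cvg_id.
  by rewrite ln0 ?mulr0 ?ltW.
- rewrite /continuous_at mul0r; apply/norm_cvg0P.
  have z1 : \forall z \near (0:R), `|z| < 1.
    by exists 1 => //= z /=; rewrite sub0r normrN.
  apply: (@squeeze_cvgr _ _ _ _ (cst 0) (fun z => 2 * Num.sqrt `|z|)).
  + by near=> z; rewrite normr_ge0/= norm_xlnx_le//; near: z.
  + exact: cvg_cst.
  + rewrite -[X in _ --> X](_ : 2 * Num.sqrt `|0 : R| = 0); last by rewrite normr0 sqrtr0 mulr0.
    apply: cvgM; first exact: cvg_cst.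
    apply: (@continuous_comp _ _ _ (fun z : R => `|z|) Num.sqrt); first exact: norm_continuous.
    exact: sqrt_continuous.
Unshelve. all: by end_near. Qed.

Lemma onem_continuous : continuous (fun x : R => 1 - x).
Proof. by move=> x; apply: cvgB; [exact: cvg_cst|exact: cvg_id]. Qed.

Lemma Hbin_continuous n : continuous (@Hbin R n).
Proof.
move=> x; apply: cvgM; first exact: cvg_cst.
apply: cvgD; first exact: xlnx_continuous.
apply: (@continuous_comp _ _ _ (fun x : R => 1 - x) (fun x : R => x * ln x)).
  exact: onem_continuous.
exact: xlnx_continuous.
Qed.

Lemma binW_continuous n y : continuous (@binW R n y).
Proof.
move=> x; apply: cvgM; first by apply: cvgM; [exact: cvg_cst|exact: exprn_continuous].
apply: (@continuous_comp _ _ _ (fun x : R => 1 - x) (fun x : R => x ^+ (n - y))).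
  exact: onem_continuous.
exact: exprn_continuous.
Qed.

Lemma big_sum_continuous m (f : nat -> R -> R) : (forall i, continuous (f i)) ->
  continuous (fun x => \sum_(i < m) f i x).
Proof.
move=> cf; elim: m => [|m IH] x.
  rewrite (_ : (fun _ => _) = cst 0); first exact: cvg_cst.
  by apply/funext => z; rewrite big_ord0.
rewrite (_ : (fun _ => _) = (fun x => \sum_(i < m) f i x + f m x)).
  by apply: cvgD; [exact: IH|exact: cf].
by apply/funext => z; rewrite big_ord_recr.
Qed.

Lemma Ebin_continuous n (f : nat -> R) : continuous (fun x => Ebin n x f).
Proof.
apply: (@big_sum_continuous n.+1 (fun y x => binW n y x * f y)) => y x.
by apply: cvgM; [exact: binW_continuous|exact: cvg_cst].
Qed.

Lemma psi_continuous n : continuous (@psi R n).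
Proof. by move=> x; apply: cvgB; [exact: Ebin_continuous|exact: Hbin_continuous]. Qed.

(** A common interface for averaging over the arcsine law and over an input distribution.
    Restricting it to continuous functions spares every later integrability side condition. *)
Record is_mean (L : (R -> R) -> R) : Prop := IsMean {
  mean_cst : forall c, L (fun=> c) = c;
  meanD : forall f g : R -> R, continuous f -> continuous g ->
    L (fun x => f x + g x) = L f + L g;
  meanZ : forall (c : R) (f : R -> R), continuous f -> L (fun x => c * f x) = c * L f;
  mean_le : forall f g : R -> R, continuous f -> continuous g ->
    (forall x, 0 <= x <= 1 -> f x <= g x) -> L f <= L g }.

Section mean.
Variables (L : (R -> R) -> R) (Lm : is_mean L).

Lemma meanB (f g : R -> R) : continuous f -> continuous g ->
  L (fun x => f x - g x) = L f - L g.
Proof.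
move=> cf cg.
have cN : continuous (fun x => -1 * g x) by move=> x; apply: cvgM; [exact: cvg_cst|exact: cg].
rewrite -(mulN1r (L g)) -(meanZ Lm)// -(meanD Lm)//.
by congr L; apply/funext => x; rewrite mulN1r.
Qed.

Lemma mean_sum m (f : nat -> R -> R) : (forall i, continuous (f i)) ->
  L (fun x => \sum_(i < m) f i x) = \sum_(i < m) L (f i).
Proof.
move=> cf; elim: m => [|m IH].
  rewrite big_ord0 -[RHS](mean_cst Lm); congr L; apply/funext => x.
  by rewrite big_ord0.
rewrite big_ord_recr/= -IH -(meanD Lm)//; last exact: big_sum_continuous.
by congr L; apply/funext => x; rewrite big_ord_recr.
Qed.

Lemma mean_Ebin n (f : nat -> R) :
  L (fun x => Ebin n x f) = \sum_(y < n.+1) L (binW n y) * f y.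
Proof.
rewrite (@mean_sum _ (fun y x => binW n y x * f y)) => [|y x]; last first.
  by apply: cvgM; [exact: binW_continuous|exact: cvg_cst].
apply: eq_bigr => y _; rewrite mulrC -(meanZ Lm); last exact: binW_continuous.
by congr L; apply/funext => x; rewrite mulrC.
Qed.

Lemma mean_binW_sum n : \sum_(y < n.+1) L (binW n y) = 1.
Proof.
have <- : L (fun x => Ebin n x (fun=> 1)) = 1.
  by rewrite -[RHS](mean_cst Lm); congr L; apply/funext => x; rewrite Ebin1.
by rewrite mean_Ebin; apply: eq_bigr => y _; rewrite mulr1.
Qed.

Lemma mean_binW_ge0 n y : 0 <= L (binW n y).
Proof.
rewrite -[leLHS](mean_cst Lm 0); apply: (mean_le Lm).
- by move=> x; exact: cvg_cst.
- exact: binW_continuous.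
- by move=> x; exact: binW_ge0.
Qed.

End mean.

(** The arcsine law as the law of cos^2 t with t uniform on [0, pi/2], which avoids the singular
    density. *)
Definition arcsine_mean (f : R -> R) : R :=
  (pi / 2)^-1 * \int[mu]_(t in `[0, pi / 2]) f (cos t ^+ 2).

Let integ (f : R -> R) a b : continuous f -> mu.-integrable `[a, b] (EFin \o f).
Proof.
move=> cf; apply: continuous_compact_integrable; first exact: segment_compact.
exact: continuous_subspaceT.
Qed.

Let cosX_continuous k : continuous (fun t : R => cos t ^+ k).
Proof.
move=> t; apply: (@continuous_comp _ _ _ cos (fun x : R => x ^+ k)).
  exact: continuous_cos.
exact: exprn_continuous.
Qed.

Let sinX_continuous k : continuous (fun t : R => sin t ^+ k).
Proof.
move=> t; apply: (@continuous_comp _ _ _ sin (fun x : R => x ^+ k)).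
  exact: continuous_sin.
exact: exprn_continuous.
Qed.

Let comp_cos2 (f : R -> R) : continuous f -> continuous (fun t => f (cos t ^+ 2)).
Proof. by move=> cf t; apply: (@continuous_comp _ _ _ (fun t => cos t ^+ 2) f); [exact: cosX_continuous|exact: cf]. Qed.

Let pi2_gt0 : 0 < pi / 2 :> R. Proof. by rewrite divr_gt0 ?pi_gt0. Qed.

Lemma arcsine_is_mean : is_mean arcsine_mean.
Proof.
split.
- move=> c; rewrite /arcsine_mean Rintegral_cst//= lebesgue_measure_itv/= lte_fin pi2_gt0/= subr0.
  by rewrite mulrC mulfK// gt_eqF.
- move=> f g cf cg; rewrite /arcsine_mean -mulrDr -RintegralD//; apply: integ; exact: comp_cos2.
- move=> c f cf; rewrite /arcsine_mean RintegralZl//; [by rewrite mulrCA|apply: integ; exact: comp_cos2].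
- move=> f g cf cg fg; rewrite /arcsine_mean ler_wpM2l ?invr_ge0 ?(ltW pi2_gt0)//.
  apply: le_Rintegral => //; [apply: integ; exact: comp_cos2..|].
  move=> t _; apply: fg; rewrite sqr_ge0/= -(cos2Dsin2 t) lerDl sqr_ge0//.
Qed.

(** Half the Beta function at (y + 1/2, z + 1/2). *)
Let mom y z : R := \int[mu]_(t in `[0, pi / 2]) (cos t ^+ (y.*2) * sin t ^+ (z.*2)).

Let cs_continuous y z : continuous (fun t : R => cos t ^+ y * sin t ^+ z).
Proof. by move=> t; apply: cvgM; [exact: cosX_continuous|exact: sinX_continuous]. Qed.

Let mom_add y z : mom y.+1 z + mom y z.+1 = mom y z.
Proof.
rewrite /mom -RintegralD//; try (apply: integ; exact: cs_continuous).
apply: eq_Rintegral => t _; rewrite !doubleS !exprS.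
rewrite -[RHS]mulr1 -(cos2Dsin2 t); ring.
Qed.

(** The function cos^(2y+1) sin^(2z+1) vanishes at both ends of [0, pi/2], so its derivative
    integrates to 0. *)
Let mom_parts y z : (2 * z%:R + 1) * mom y.+1 z = (2 * y%:R + 1) * mom y z.+1.
Proof.
have dF (t : R) : is_derive t 1 (fun t => cos t ^+ y.*2.+1 * sin t ^+ z.*2.+1)
  ((2 * z%:R + 1) * (cos t ^+ y.+1.*2 * sin t ^+ z.*2) -
   (2 * y%:R + 1) * (cos t ^+ y.*2 * sin t ^+ z.+1.*2)).
  have -> : (fun t : R => cos t ^+ y.*2.+1 * sin t ^+ z.*2.+1) =
      cos ^+ y.*2.+1 * sin ^+ z.*2.+1 by apply/funext => u; rewrite !fctE.
  apply: (is_derive_eq (is_deriveM (is_deriveX y.*2.+1 (is_derive_cos t)) (is_deriveX z.*2.+1 (is_derive_sin t)))).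
  rewrite /GRing.scale/= !fctE/= !doubleS !exprS -!natr1 -!muln2 !natrM; ring.
have cf : continuous (fun t : R => (2 * z%:R + 1) * (cos t ^+ y.+1.*2 * sin t ^+ z.*2) -
   (2 * y%:R + 1) * (cos t ^+ y.*2 * sin t ^+ z.+1.*2)).
  by move=> t; apply: cvgB; (apply: cvgM; [exact: cvg_cst|exact: cs_continuous]).
have F := @continuous_FTC2 R _ (fun t => cos t ^+ y.*2.+1 * sin t ^+ z.*2.+1) 0 (pi / 2) pi2_gt0
  (continuous_subspaceT cf).
have E : \int[mu]_(t in `[0, pi / 2]) ((2 * z%:R + 1) * (cos t ^+ y.+1.*2 * sin t ^+ z.*2) -
   (2 * y%:R + 1) * (cos t ^+ y.*2 * sin t ^+ z.+1.*2)) = 0.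
  rewrite /Rintegral F.
  - by rewrite cos_pihalf sin0 !expr0n/= mul0r mulr0 subrr.
  - split=> [t _||].
    + by have [] := dF t.
    + exact/cvg_at_right_filter/cs_continuous.
    + exact/cvg_at_left_filter/cs_continuous.
  - by move=> t _; rewrite derive1E; have [] := dF t.
apply/eqP; rewrite -subr_eq0; apply/eqP; rewrite -E /mom.
rewrite -!RintegralZl// ?RintegralB//; try (apply: integ; exact: cs_continuous).
all: by apply: integ => t; apply: cvgM; [exact: cvg_cst|exact: cs_continuous].
Qed.

(** The linear system formed by [mom_add] and [mom_parts] expresses both successors of [mom a z]
    through [mom a z]; induction from [mom 0 0] = pi/2 gives all moments. *)
Lemma arcsine_moment n y : (y <= n)%N -> arcsine_mean (binW n y) = Yref R n y.
Proof.
have y0 k : 0 <= k%:R :> R by [].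
have momSl a z : mom a.+1 z = (2 * a%:R + 1) / (2 * (a%:R + z%:R + 1)) * mom a z.
  have ha := y0 a; have hz := y0 z.
  have := mom_parts a z; have := mom_add a z => <- h.
  apply: (@mulfI _ (2 * (a%:R + z%:R + 1))); first by rewrite gt_eqF//; lra.
  rewrite mulrA mulrCA divff ?mulr1; last by rewrite gt_eqF//; lra.
  by lra.
have momSr a z : mom a z.+1 = (2 * z%:R + 1) / (2 * (a%:R + z%:R + 1)) * mom a z.
  have ha := y0 a; have hz := y0 z.
  have := mom_parts a z; have := mom_add a z => <- h.
  apply: (@mulfI _ (2 * (a%:R + z%:R + 1))); first by rewrite gt_eqF//; lra.
  rewrite mulrA mulrCA divff ?mulr1; last by rewrite gt_eqF//; lra.
  by lra.
have momE a z : mom a z = pi / 2 * (wallis R a * wallis R z * a`!%:R * z`!%:R / (a + z)`!%:R).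
  elim: a => [|a IH].
    elim: z => [|z IH].
      rewrite wallis0 fact0 divr1 !mulr1.
      have -> : mom 0 0 = \int[mu]_(t in `[0, pi / 2]) 1.
        by apply: eq_Rintegral => t _; exact: (mulr1 1).
      by rewrite Rintegral_cst//= lebesgue_measure_itv/= lte_fin pi2_gt0/= subr0 mul1r.
    rewrite momSr IH !add0n wallisS factS natrM -[z.+1%:R]natr1 add0r.
    have hz := y0 z; have f0 : z`!%:R != 0 :> R by rewrite pnatr_eq0 -lt0n fact_gt0.
    by field; rewrite f0 !gt_eqF//; lra.
  rewrite momSl IH addSn wallisS !factS !natrM -[a.+1%:R]natr1 -[(a + z).+1%:R]natr1 natrD.
  have hz := y0 z; have ha := y0 a.
  have f0 : (a + z)`!%:R != 0 :> R by rewrite pnatr_eq0 -lt0n fact_gt0.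
  by field; rewrite f0 !gt_eqF//; lra.
move=> yn; rewrite /arcsine_mean.
have -> : \int[mu]_(t in `[0, pi / 2]) binW n y (cos t ^+ 2) = 'C(n, y)%:R * mom y (n - y).
  rewrite /mom -RintegralZl//; last (apply: integ; exact: cs_continuous).
  apply: eq_Rintegral => t _; rewrite /binW.
  have -> : 1 - cos t ^+ 2 = sin t ^+ 2 by rewrite -(cos2Dsin2 t); ring.
  by rewrite -!exprM !mul2n mulrA.
have f0 k : k`!%:R != 0 :> R by rewrite pnatr_eq0 -lt0n fact_gt0.
rewrite momE subnKC// -(bin_fact yn) !natrM /Yref.
have C0 : 'C(n, y)%:R != 0 :> R by rewrite pnatr_eq0 -lt0n bin_gt0.
have := pi2_gt0; set p := pi / 2 => p0; field.
by rewrite C0 !f0 gt_eqF.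
Qed.

Lemma Yref_sum n : \sum_(y < n.+1) Yref R n y = 1.
Proof.
rewrite -(mean_binW_sum arcsine_is_mean n); apply: eq_bigr => y _.
by rewrite arcsine_moment// -ltnS.
Qed.

End arcsine.

(** * Optimality conditions *)

Section input_distributions.
Variable R : realType.
Implicit Types (x u s t : R) (n y k : nat) (P Q : probability R R).

Definition input_mean P (f : R -> R) : R := \int[P]_(x in `[0, 1]) f x.

Lemma continuous_itv01_bounded (f : R -> R) : continuous f ->
  exists2 M, 0 <= M & forall x, 0 <= x <= 1 -> `|f x| <= M.
Proof.
move=> cf.
have cA : {within `[0, 1], continuous f} by exact: continuous_subspaceT.
have /compact_bounded[M [_ mrt]] := continuous_compact cA (@segment_compact _ 0 1).
exists (Num.max 0 (M + 1)); first by rewrite le_max lexx.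
move=> x x01; rewrite le_max; apply/orP; right.
by apply: mrt; [rewrite ltrDl|exists x => //=; rewrite in_itv].
Qed.

Lemma continuous_integrable_itv01 P (f : R -> R) : continuous f ->
  P.-integrable `[0, 1] (EFin \o f).
Proof.
move=> cf; apply: measurable_bounded_integrable => //.
- exact: (le_lt_trans (probability_le1 _ _) (ltry 1)).
- by apply: measurable_funTS; exact: continuous_measurable_fun.
- have [M M0 Mf] := continuous_itv01_bounded cf.
  exists M; split; rewrite ?num_real // => z Mz x /=; rewrite in_itv/= => x01.
  by rewrite (le_trans (Mf _ _))// ltW.
Qed.

Lemma input_mean_is_mean P : input_dist R P -> is_mean (input_mean P).
Proof.
move=> iP; split.
- by move=> c; rewrite /input_mean Rintegral_cst// [X in fine X]iP mulr1.
- by move=> f g cf cg; rewrite /input_mean RintegralD//; exact: continuous_integrable_itv01.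
- by move=> c f cf; rewrite /input_mean RintegralZl//; exact: continuous_integrable_itv01.
- move=> f g cf cg fg; apply: le_Rintegral => //.
  + exact: continuous_integrable_itv01.
  + exact: continuous_integrable_itv01.
Qed.

Lemma mixture_exists P x0 t : input_dist R P -> 0 <= x0 <= 1 -> 0 < t < 1 ->
  exists2 Q : probability R R, input_dist R Q &
    forall f, continuous f -> input_mean Q f = (1 - t) * input_mean P f + t * f x0.
Proof.
move=> iP x01 /andP[t0 t1].
have t1' : 0 <= 1 - t by rewrite subr_ge0 ltW.
have t0' := ltW t0.
pose nu := measure_add (mscale (NngNum t1') P) (mscale (NngNum t0') (dirac x0)).
have nuE A : nu A = ((1 - t)%:E * P A + t%:E * \d_x0 A)%E.
  by rewrite /nu /measure_add /= /msum !big_ord_recr/= big_ord0 add0e.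
have nuT : nu [set: R] = 1%E.
  rewrite nuE probability_setT diracT !mule1 -EFinD; congr _%:E; ring.
(* nu has mass 1 already: mnormalize only packages it as a probability. *)
pose Q := mnormalize nu P.
have QE A : Q A = nu A.
  rewrite /Q /mnormalize; case: ifPn => [|_]; last by rewrite [X in fine X]nuT invr1 mule1.
  by rewrite [X in (X == 0)%E]nuT [X in (X == +oo)%E]nuT onee_eq0.
have iQ : input_dist R Q.
  rewrite /input_dist [LHS]QE nuE [X in (_ * X)%E]iP diracE mem_set ?in_itv//=.
  by rewrite !mule1 -EFinD; congr _%:E; ring.
exists Q => // f cf.
have mQ := input_mean_is_mean iQ; have mP := input_mean_is_mean iP.
have [M M0 Mf] := continuous_itv01_bounded cf.
have ccst : continuous (fun _ : R => M : R) by exact: cst_continuous.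
(* Adding a bound of |f| makes the integrand nonnegative on [0, 1], so the integral over a sum of
   measures splits; the constant is removed by linearity. *)
pose g x := f x + M.
have cg : continuous g by move=> x; apply: cvgD; [exact: cf|exact: cvg_cst].
suff : input_mean Q g = (1 - t) * input_mean P g + t * g x0.
  by rewrite /g (meanD mQ)// (meanD mP)// (mean_cst mQ) (mean_cst mP); lra.
have g0 x : 0 <= x <= 1 -> 0 <= g x.
  by move=> /Mf; rewrite ler_norml => /andP[+ _]; rewrite /g; lra.
have mg : measurable_fun (`[0, 1]%classic : set R) (EFin \o g).
  by apply/measurable_EFinP/measurable_funTS; exact: continuous_measurable_fun.
have g0' x : (`[0, 1]%classic : set R) x -> (0 <= (EFin \o g) x)%E.
  by rewrite /= in_itv/= lee_fin => /g0.
rewrite {1}/input_mean /Rintegral (eq_measure_integral nu); last by move=> A _ _; exact: QE.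
rewrite ge0_integral_measure_add// !ge0_integral_mscale// integral_dirac//.
rewrite diracE mem_set ?in_itv//= mul1e.
rewrite fineD//; last first.
  rewrite fin_numM//.
  exact: (integrable_fin_num _ (continuous_integrable_itv01 P cg)).
rewrite fineM//.
exact: (integrable_fin_num _ (continuous_integrable_itv01 P cg)).
Qed.

End input_distributions.

Section mutual_information.
Variable R : realType.
Implicit Types (x u s t : R) (n y k : nat) (P Q : probability R R).

Lemma gibbs_term (a c : R) : 0 <= a -> 0 < c -> a - c <= a * ln a - a * ln c.
Proof.
rewrite le_eqVlt => /predU1P[<-|a0] c0; first by rewrite !mul0r; lra.
have /xlnx_ge_sub1 : 0 <= a / c by rewrite divr_ge0 ?ltW.
rewrite ln_div ?posrE// -(ler_pM2l c0).
have -> : c * (a / c - 1) = a - c by field; rewrite gt_eqF.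
have -> : c * (a / c * (ln a - ln c)) = a * ln a - a * ln c by field; rewrite gt_eqF.
by [].
Qed.

Lemma gibbs_sum m (p q : nat -> R) : (forall i, (i < m)%N -> 0 <= p i) ->
  (forall i, (i < m)%N -> 0 < q i) ->
  \sum_(i < m) p i = 1 -> \sum_(i < m) q i = 1 ->
  \sum_(i < m) p i * ln (q i) <= \sum_(i < m) p i * ln (p i).
Proof.
move=> p0 q0 p1 q1; rewrite -subr_ge0 -sumrB.
apply: le_trans (_ : \sum_(i < m) (p i - q i) <= _); first by rewrite sumrB p1 q1 subrr.
by apply: ler_sum => i _; apply: gibbs_term; [exact: p0|exact: q0].
Qed.

Lemma xlnx_convex (a b t : R) : 0 <= a -> 0 <= b -> 0 < t < 1 ->
  ((1 - t) * a + t * b) * ln ((1 - t) * a + t * b) <=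
    (1 - t) * (a * ln a) + t * (b * ln b).
Proof.
move=> a0 b0 /andP[t0 t1]; set c := (1 - t) * a + t * b.
have t1' : 0 < 1 - t by lra.
have c0 : 0 <= c by rewrite addr_ge0 ?mulr_ge0 ?(ltW t1') ?(ltW t0).
move: c0; rewrite le_eqVlt => /predU1P[c0|c0].
  have /andP[] : ((1 - t) * a == 0) && (t * b == 0).
    by rewrite -paddr_eq0 ?mulr_ge0 ?(ltW t1') ?(ltW t0)// -/c -c0.
  rewrite !mulf_eq0 (gt_eqF t0) (gt_eqF t1')/= => /eqP-> /eqP->.
  by rewrite -c0 !mul0r !mulr0 addr0.
(* These are tangent inequalities at the common point c; in their weighted sum the linear parts
   cancel. *)
have ha := gibbs_term a0 c0; have hb := gibbs_term b0 c0.
have {}ha := ler_wpM2l (ltW t1') ha; have {}hb := ler_wpM2l (ltW t0) hb.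
move: ha hb; set lc := ln c; rewrite /c => ha hb.
by move: (lerD ha hb); lra.
Qed.

Lemma xlnx_comp_continuous (W : R -> R) : continuous W ->
  continuous (fun x => W x * ln (W x)).
Proof.
move=> cW x; apply: (@continuous_comp _ _ _ W (fun u : R => u * ln u)); first exact: cW.
exact: xlnx_continuous.
Qed.

(* Needed because ln (W / 0) = 0: outputs of probability zero disappear from mutual_info, but not from the sum of W ln W. *)
Lemma mean_xlnx_ge0 (L : (R -> R) -> R) (W : R -> R) : is_mean L -> continuous W ->
  (forall x, 0 <= x <= 1 -> 0 <= W x) -> L W = 0 ->
  0 <= L (fun x => W x * ln (W x)).
Proof.
move=> Lm cW W0 LW; apply/ler_addgt0Pr => e e0.
have cZ (c : R) : continuous (fun x => c * W x).
  by move=> x; apply: cvgM; [exact: cvg_cst|exact: cW].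
have -> : e = L (fun=> e) by rewrite (mean_cst Lm).
have ce : continuous (fun _ : R => e : R) by exact: cst_continuous.
rewrite -(meanD Lm)//; last exact: xlnx_comp_continuous.
rewrite -[leLHS](_ : L (fun x => (1 + ln e) * W x) = 0); last by rewrite (meanZ Lm)// LW mulr0.
apply: (mean_le Lm) => //.
  by move=> x; apply: cvgD; [exact: xlnx_comp_continuous|exact: ce].
by move=> x x01; have := gibbs_term (W0 _ x01) e0; lra.
Qed.

(** The negative entropy of W_x. This form isolates [Hbin], which also occurs in [psi] and
    [ln_Yref]. *)
Definition Phi n x : R := Hbin n x + Ebin n x (fun y => ln 'C(n, y)%:R).

Lemma Phi_continuous n : continuous (Phi n).
Proof. by move=> x; apply: cvgD; [exact: Hbin_continuous|exact: Ebin_continuous]. Qed.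

Lemma PhiE n x : 0 <= x <= 1 -> Phi n x = \sum_(y < n.+1) binW n y x * ln (binW n y x).
Proof.
move=> x01.
have [x0|x1|] := itv01_cases x01.
- rewrite x0 /Phi Hbin0 Ebin0 bin0 ln1 addr0 big_ord_recl/= big1 => [|i _].
    by rewrite /binW bin0 expr0 subr0 expr1n !mulr1 ln1 mulr0 addr0.
  by rewrite /binW exprS !mul0r !mulr0 !mul0r.
- rewrite x1 /Phi Hbin1 Ebin_at1 binn ln1 addr0 big_ord_recr/= big1 => [|i _].
    by rewrite /binW binn subnn expr0 expr1n !mulr1 ln1 mulr0 addr0.
  by rewrite /binW subrr expr0n subn_eq0 leqNgt ltn_ord/= mulr0 mul0r.
case/andP=> x0 x1; have x1' : 0 < 1 - x by lra.
rewrite /Phi; have -> : Hbin n x = Ebin n x (fun y => n%:R * ln (1 - x) + (ln x - ln (1 - x)) * y%:R).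
  by rewrite EbinD Ebin_cst EbinZ Ebin_id /Hbin; ring.
rewrite -EbinD; apply: eq_bigr => y _; congr (_ * _).
have yn : (y <= n)%N by rewrite -ltnS.
have C0 : 0 < 'C(n, y)%:R :> R by rewrite ltr0n bin_gt0.
rewrite /binW !lnM ?posrE ?mulr_gt0 ?exprn_gt0// !lnXn// -[ln x *+ _]mulr_natr -[ln (1 - x) *+ _]mulr_natr natrB//; ring.
Qed.

Section capacity.
Variable n : nat.

Lemma out_pmfE P y : out_pmf n P y = input_mean P (binW n y).
Proof. by []. Qed.

Lemma mutual_infoE P : input_dist R P ->
  mutual_info n P = input_mean P (Phi n) -
    \sum_(y < n.+1) out_pmf n P y * ln (out_pmf n P y).
Proof.
move=> iP; have Lm := input_mean_is_mean iP; set L := input_mean P in Lm *.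
pose q := out_pmf n P.
(* [G] collects the W ln W terms of outputs with probability zero, which [mutual_info] omits. Its
   mean is 0: nonpositive because W <= 1, nonnegative by [mean_xlnx_ge0]. *)
pose G x := \sum_(y < n.+1) (q y == 0)%:R * (binW n y x * ln (binW n y x)).
have cGy y : continuous (fun x => (q y == 0)%:R * (binW n y x * ln (binW n y x))).
  by move=> x; apply: cvgM; [exact: cvg_cst|apply: xlnx_comp_continuous; exact: binW_continuous].
have cG : continuous G by apply: (@big_sum_continuous _ _ (fun y x => (q y == 0)%:R * (binW n y x * ln (binW n y x)))).
have q0 y : 0 <= q y by exact: mean_binW_ge0.
have bW y x : 0 <= x <= 1 -> (y <= n)%N -> binW n y x <= 1.
  move=> x01; rewrite -ltnS => yn; rewrite -(Ebin1 n x) /Ebin (bigD1 (Ordinal yn))//= mulr1 lerDl.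
  by apply: sumr_ge0 => i _; rewrite mulr1 binW_ge0.
have LG : L G = 0.
  rewrite (mean_sum Lm n.+1 cGy) big1// => y _.
  have [qy|qy] := eqVneq (q y) 0; last first.
    rewrite -[RHS](mean_cst Lm); congr L; apply/funext => x; rewrite mul0r//.
  have cW : continuous (@binW R n y) by exact: binW_continuous.
  rewrite (meanZ Lm); last exact: xlnx_comp_continuous.
  rewrite mul1r; apply/eqP; rewrite eq_le mean_xlnx_ge0//; last by move=> x; exact: binW_ge0.
  rewrite andbT -[leRHS](mean_cst Lm); apply: (mean_le Lm).
  - exact: xlnx_comp_continuous.
  - exact: cst_continuous.
  - move=> x x01; rewrite mulr_ge0_le0 ?binW_ge0// ln_le0// bW// -ltnS//.
have -> : \sum_(y < n.+1) out_pmf n P y * ln (out_pmf n P y) =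
    L (fun x => Ebin n x (fun y => ln (q y))) by rewrite (mean_Ebin Lm).
rewrite -[RHS]subr0 -LG.
rewrite -(meanB Lm); [|exact: Phi_continuous|exact: Ebin_continuous].
rewrite -(meanB Lm); [|by move=> x; apply: cvgB; [exact: Phi_continuous|exact: Ebin_continuous]|by []].
rewrite /mutual_info; apply: eq_Rintegral => x; rewrite inE/= in_itv/= => x01.
rewrite PhiE// /Ebin /G -!sumrB; apply: eq_bigr => y _; rewrite -/(q y).
have [->|qy] := eqVneq (q y) 0.
  by rewrite invr0 mulr0 ln0// mulr0 subr0 mul1r subrr.
have := binW_ge0 n y x01; rewrite le_eqVlt => /predU1P[<-|W0].
  by rewrite !mul0r !subr0.
have qy0 : 0 < q y by rewrite lt_neqAle eq_sym qy q0.
by rewrite ln_div ?posrE// mul0r subr0 mulrBr.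
Qed.

End capacity.
End mutual_information.

Section kkt.
Variables (R : realType) (n : nat) (P : probability R R).
Hypothesis capP : capacity_achieving n P.
Implicit Types (x t : R) (y : nat).

Let iP : input_dist R P. Proof. by case: capP. Qed.
Let Lm := input_mean_is_mean iP.
Let q y := out_pmf n P y.
Let N (p : nat -> R) := \sum_(y < n.+1) p y * ln (p y).
Let cap := mutual_info n P.

Let q_ge0 y : 0 <= q y. Proof. exact: (mean_binW_ge0 Lm). Qed.
Let q_sum : \sum_(y < n.+1) q y = 1. Proof. exact: (mean_binW_sum Lm). Qed.

Let capE : cap = input_mean P (Phi n) - N q. Proof. exact: mutual_infoE. Qed.

Let mixture_le x t : 0 <= x <= 1 -> 0 < t < 1 ->
  t * (Phi n x - input_mean P (Phi n)) <=
    N (fun y => (1 - t) * q y + t * binW n y x) - N q.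
Proof.
move=> x01 t01; have [Q iQ QE] := mixture_exists iP x01 t01.
have := capP.2 _ iQ; rewrite -/cap capE mutual_infoE// QE; last exact: Phi_continuous.
have -> : \sum_(y < n.+1) out_pmf n Q y * ln (out_pmf n Q y) =
   N (fun y => (1 - t) * q y + t * binW n y x).
  by apply: eq_bigr => y _; rewrite out_pmfE QE//; exact: binW_continuous.
by lra.
Qed.

(** If q(y) = 0, mixing in a point mass at 1/2 with weight t gains -t w ln t in output entropy at y,
    while convexity controls the other outputs. As t tends to 0 this beats every linear cost. *)
Lemma out_pmf_gt0 y : (y <= n)%N -> 0 < out_pmf n P y.
Proof.
move=> yn; rewrite lt_neqAle q_ge0 andbT eq_sym; apply/eqP => qy.
pose w := binW n y (2^-1 : R).
have h01 : 0 <= (2^-1 : R) <= 1 by rewrite invr_ge0 ler0n invf_le1 ?ltr0n ?ler1n.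
have w0 : 0 < w.
  by rewrite /w /binW !mulr_gt0 ?exprn_gt0 ?ltr0n ?bin_gt0//; lra.
have key t : 0 < t < 1 -> - (w * ln t) <= cap.
  move=> t01; have [t0 t1] : 0 < t /\ t < 1 by move/andP: t01.
  have := mixture_le h01 t01.
  have : N (fun y => (1 - t) * q y + t * binW n y 2^-1) <=
      (1 - t) * N q + t * Phi n 2^-1 + t * (w * ln t).
    have yn' : (y < n.+1)%N by [].
    rewrite PhiE// /N !mulr_sumr -big_split/=.
    rewrite (bigD1 (Ordinal yn'))//= [X in _ <= X + _](bigD1 (Ordinal yn'))//=.
    have qy' : q y = 0 by [].
    rewrite qy' -/w mul0r !mulr0 !add0r addrAC lerD//.
      by rewrite lnM ?posrE//; lra.
    by apply: ler_sum => i _; apply: xlnx_convex => //; exact: binW_ge0.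
  rewrite capE => h1 h2.
  rewrite -(ler_pM2l t0); lra.
have c0 : 0 <= cap.
  have h2 : 0 < (2^-1 : R) < 1 by rewrite invr_gt0 ltr0n invf_lt1 ?ltr0n ?ltr1n.
  apply: le_trans (key _ h2).
  by rewrite oppr_ge0 mulr_ge0_le0 ?(ltW w0)// ln_le0//; case/andP: h01.
have d0 : 0 < (cap + 1) / w by rewrite divr_gt0//; lra.
(* This t makes -w ln t equal to cap + 1; the bound 0 <= cap ensures t < 1. *)
have := key (expR (- ((cap + 1) / w))) _; rewrite expR_gt0 expR_lt1 oppr_lt0 d0.
rewrite expRK => /(_ isT).
have -> : w * - ((cap + 1) / w) = - (cap + 1) by field; rewrite gt_eqF.
by lra.
Qed.

Definition divergence x := Phi n x - Ebin n x (fun y => ln (out_pmf n P y)).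

Lemma divergence_continuous : continuous divergence.
Proof. by move=> x; apply: cvgB; [exact: Phi_continuous|exact: Ebin_continuous]. Qed.

Lemma divergence_mean : input_mean P divergence = cap.
Proof.
rewrite capE (meanB Lm); [|exact: Phi_continuous|exact: Ebin_continuous].
by rewrite (mean_Ebin Lm).
Qed.

(** First-order optimality towards the point mass at x. The second-order error is at most t^2 K,
    with K the chi-squared divergence of W_x from q; dividing by t and letting t tend to 0
    concludes. *)
Lemma divergence_le x : 0 <= x <= 1 -> divergence x <= cap.
Proof.
move=> x01.
pose K := \sum_(y < n.+1) (binW n y x - q y) ^+ 2 / q y.
have K0 : 0 <= K.
  by apply: sumr_ge0 => y _; rewrite divr_ge0 ?sqr_ge0.
suff h t : 0 < t < 1 -> divergence x <= cap + t * K.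
  apply/ler_addgt0Pr => e e0.
  pose t := Num.min (2^-1) (e / (K + 1)).
  have K1 : 0 < K + 1 by lra.
  have t0 : 0 < t by rewrite lt_min divr_gt0// andbT; lra.
  have t1 : t < 1 by rewrite gt_min; apply/orP; left; lra.
  apply: le_trans (h t _) _; first by rewrite t0.
  rewrite lerD2l; apply: le_trans (_ : e / (K + 1) * (K + 1) <= _).
    by rewrite ler_pM ?(ltW t0)//; [rewrite ge_min lexx orbT|lra].
  by rewrite divfK ?gt_eqF.
move=> t01; have [t0 t1] : 0 < t /\ t < 1 by move/andP: t01.
have := mixture_le x01 t01.
have : N (fun y => (1 - t) * q y + t * binW n y x) - N q <=
   t * (\sum_(y < n.+1) binW n y x * ln (q y) - N q) + t * (t * K).
  apply: le_trans (_ : \sum_(y < n.+1) (t * ((binW n y x - q y) * ln (q y))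
     + t * (binW n y x - q y) + t ^+ 2 * ((binW n y x - q y) ^+ 2 / q y)) <= _); last first.
    rewrite !big_split/= -!mulr_sumr [X in _ + t * X + _]sumrB q_sum.
    have -> : \sum_(i < n.+1) binW n i x = 1.
      by rewrite -(Ebin1 n x) /Ebin; apply: eq_bigr => i _; rewrite mulr1.
    rewrite subrr mulr0 addr0 -/K expr2 -mulrA lerD2r.
    rewrite (_ : \sum_(i < n.+1) (binW n i x - q i) * ln (q i) = \sum_(y < n.+1) binW n y x * ln (q y) - N q)//.
    by rewrite /N -sumrB; apply: eq_bigr => i _; rewrite mulrBl.
  rewrite /N -sumrB; apply: ler_sum => y _.
  have qy : 0 < q y by apply: out_pmf_gt0; rewrite -ltnS.
  set W := binW n y x; have W0 : 0 <= W by exact: binW_ge0.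
  set c := (1 - t) * q y + t * W.
  have t1' : 0 < 1 - t by lra.
  have c0 : 0 < c by have := mulr_gt0 t1' qy; have := mulr_ge0 (ltW t0) W0; rewrite /c; lra.
  (* Since c = q + t (W - q), the product c (c/q - 1) is t (W - q) + t^2 (W - q)^2/q, and its linear
     part sums to zero over y. *)
  have : ln (c / q y) <= c / q y - 1 by apply: ln_le_sub1; rewrite divr_gt0.
  move/(ler_wpM2l (ltW c0)); rewrite ln_div ?posrE//.
  have -> : c * (c / q y - 1) = t * (W - q y) + t ^+ 2 * ((W - q y) ^+ 2 / q y).
    by rewrite /c; field; rewrite gt_eqF.
  move: (ln c) => lc; move: (ln (q y)) => lq; rewrite /c; lra.
move=> h1 /le_trans/(_ h1) h2.
have : t * divergence x <= t * (cap + t * K).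
  rewrite /divergence capE /Ebin; move: h2; rewrite /q; lra.
by rewrite ler_pM2l.
Qed.

Definition tight := [set x : R | 0 <= x <= 1 /\ divergence x = cap].

Lemma tight_closed : closed tight.
Proof.
have -> : tight = `[0, 1]%classic `&` divergence @^-1` [set cap].
  by apply/seteqP; split=> x; rewrite /tight/= in_itv/=.
apply: closedI; first exact: itv_closed.
apply: closed_comp => [x _|]; first exact: divergence_continuous.
exact: closed_eq.
Qed.

Let tight_measurable : measurable tight.
Proof. exact: closed_measurable tight_closed. Qed.

(** The gap cap - [divergence] is nonnegative on [0, 1] with mean zero, hence vanishes almost
    everywhere. *)
Let itv_tight_null : P (`[0, 1]%classic `\` tight) = 0%E.
Proof.
pose f x := cap - divergence x.
have cc : continuous (fun _ : R => cap : R) by exact: cst_continuous.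
have cf : continuous f by move=> x; apply: cvgB; [exact: cvg_cst|exact: divergence_continuous].
have f0 x : 0 <= x <= 1 -> 0 <= f x by move=> x01; rewrite subr_ge0 divergence_le.
have fi := continuous_integrable_itv01 P cf.
have If : (\int[P]_(x in `[0%R, 1%R]) (f x)%:E)%E = 0%E.
  rewrite -[LHS]fineK; last exact: (integrable_fin_num _ fi).
  rewrite -[fine _]/(input_mean P f) (meanB Lm)//; last exact: divergence_continuous.
  by rewrite (mean_cst Lm) divergence_mean subrr.
have /ae_eq_integral_abs : (\int[P]_(x in `[0%R, 1%R]) `|(f x)%:E|)%E = 0%E.
  rewrite -[RHS]If; apply: eq_integral => x; rewrite inE/= in_itv/= => x01.
  by rewrite ger0_norm// f0.
move=> h; have {h} : ae_eq P `[0, 1]%classic (EFin \o f) (cst 0%E).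
  by apply: h => //; have /integrableP[] := fi.
case=> A [mA PA0 sA].
apply/eqP; rewrite eq_le measure_ge0 andbT -PA0.
apply: le_measure; rewrite ?inE//; first exact: measurableD.
move=> x [x01 nx]; apply: sA => /= h; apply: nx; split; first by move: x01; rewrite /= in_itv.
have := h x01; move=> [] /eqP; rewrite subr_eq0 => /eqP ->//.
Qed.

Lemma input_mean_tight (f : R -> R) : continuous f ->
  input_mean P f = \int[P]_(x in tight) f x.
Proof.
move=> cf; rewrite /input_mean /Rintegral; congr fine.
rewrite (negligible_integral _ _ (continuous_integrable_itv01 P cf) itv_tight_null)//; last first.
  exact: measurableD.
congr (integral _ _ _); apply/seteqP; split => x /=.
  by case=> x01 h; apply: contrapT => nx; apply: h.
by move=> [x01 e]; split; [rewrite in_itv|case=> _; apply].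
Qed.

Lemma input_mean_le_tight (f g : R -> R) : continuous f -> continuous g ->
  (forall x, tight x -> f x <= g x) -> input_mean P f <= input_mean P g.
Proof.
move=> cf cg fg; rewrite !input_mean_tight//.
have sub : tight `<=` (`[0, 1]%classic : set R) by move=> x [x01 _]; rewrite /= in_itv.
apply: le_Rintegral => //.
- by apply: integrableS (continuous_integrable_itv01 P cf).
- by apply: integrableS (continuous_integrable_itv01 P cg).
Qed.

End kkt.

(** * Upper bound on the optimal output pmf *)

Lemma Hbin_tangent (R : realType) n (x p : R) : 0 < x < 1 -> 0 <= p <= 1 ->
  n%:R * (p - x) * (ln x - ln (1 - x)) <= Hbin n p - Hbin n x.
Proof.
move=> /andP[x0 x1] /andP[p0 p1].
have x1' : 0 < 1 - x by lra.
have p1' : 0 <= 1 - p by lra.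
have h1 := gibbs_term p0 x0; have h2 := gibbs_term p1' x1'.
rewrite /Hbin -mulrA -mulrBr ler_wpM2l//; lra.
Qed.

(** Average the tangent inequality exp v >= exp e (1 + v - e) at the mean e of the logarithms. *)
Lemma expR_jensen (R : realType) m (p z : nat -> R) :
  (forall i, (i < m)%N -> 0 <= p i) -> \sum_(i < m) p i = 1 ->
  (forall i, (i < m)%N -> 0 < z i) ->
  expR (\sum_(i < m) p i * ln (z i)) <= \sum_(i < m) p i * z i.
Proof.
move=> p0 p1 z0; set e := \sum_(i < m) p i * ln (z i).
have -> : expR e = \sum_(i < m) p i * (expR e * (1 + (ln (z i) - e))).
  under eq_bigr do rewrite mulrCA mulrDr mulr1 mulrBr.
  rewrite -mulr_sumr big_split/= sumrB -mulr_suml p1 -/e; ring.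
apply: ler_sum => i _; rewrite ler_wpM2l ?p0//.
rewrite -{2}(lnK (z0 _ (ltn_ord i))) -{2}(subrK e (ln (z i))) expRD mulrC.
by rewrite ler_wpM2r ?expR_ge0// expR_ge1Dx.
Qed.

Section output_bound.
Variables (R : realType) (n : nat) (P : probability R R).
Hypothesis n_gt0 : (0 < n)%N.
Hypothesis capP : capacity_achieving n P.
Implicit Types (x t X : R) (y : nat).

Let iP : input_dist R P. Proof. by case: capP. Qed.
Let Lm := input_mean_is_mean iP.
Let q y := out_pmf n P y.
Let cap := mutual_info n P.
Let q_gt0 y : (y <= n)%N -> 0 < q y. Proof. exact: out_pmf_gt0. Qed.
Let q_sum : \sum_(y < n.+1) q y = 1. Proof. exact: (mean_binW_sum Lm). Qed.

Let frac01 y : (y <= n)%N -> 0 <= (y%:R / n%:R : R) <= 1.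
Proof.
by move=> yn; rewrite divr_ge0//= ler_pdivrMr ?ltr0n// mul1r ler_nat.
Qed.

(** The density in X, relative to [P], of the input obtained by drawing k from W_x and then sampling
    the posterior given k; hence [kernel_ratio_mean]. *)
Definition kernel_ratio x X := Ebin n x (fun k => binW n k X / out_pmf n P k).

Let kernel_ratio_ge0 x X : 0 <= x <= 1 -> 0 <= X <= 1 -> 0 <= kernel_ratio x X.
Proof.
move=> x01 X01; rewrite /kernel_ratio -(Ebin_cst n x 0); apply: Ebin_le => // k kn.
by rewrite divr_ge0 ?binW_ge0// ltW ?q_gt0.
Qed.

Let log_kernel x X := n%:R * x * ln X + n%:R * (1 - x) * ln (1 - X).

Let binW_exp y X : 0 < X < 1 -> (y <= n)%N ->
  binW n y X = 'C(n, y)%:R * expR (log_kernel (y%:R / n%:R) X).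
Proof.
move=> /andP[X0 X1] yn; have X1' : 0 < 1 - X by lra.
have n0 : n%:R != 0 :> R by rewrite pnatr_eq0 -lt0n.
rewrite /binW -mulrA; congr (_ * _).
rewrite -[LHS]lnK ?posrE ?mulr_gt0 ?exprn_gt0//; congr expR.
rewrite lnM ?posrE ?exprn_gt0// !lnXn// -[ln X *+ _]mulr_natr -[ln (1 - X) *+ _]mulr_natr natrB//.
by rewrite /log_kernel; field.
Qed.

(* The left-hand side is exp (cap - n d(x || X)). *)
Lemma kernel_ratio_ge x X : tight n P x -> 0 < X < 1 ->
  expR (cap - Hbin n x + log_kernel x X) <= kernel_ratio x X.
Proof.
move=> [x01 xcap] X01.
pose z k := binW n k X / q k.
have [X0 X1] : 0 < X /\ X < 1 by move/andP: X01.
have X1' : 0 < 1 - X by lra.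
have W0 k : (k <= n)%N -> 0 < binW n k X.
  by move=> kn; rewrite /binW !mulr_gt0 ?exprn_gt0// ltr0n bin_gt0.
apply: le_trans (@expR_jensen _ n.+1 (fun k => binW n k x) z _ _ _).
- rewrite ler_expR le_eqVlt; apply/orP; left; apply/eqP.
  rewrite -[RHS]/(Ebin n x (fun k => ln (z k))).
  rewrite (@Ebin_eq _ _ _ _ (fun k => (ln 'C(n, k)%:R + (n%:R * ln (1 - X) + (ln X - ln (1 - X)) * k%:R)) + (-1) * ln (q k))).
    rewrite EbinD EbinZ EbinD EbinD Ebin_cst EbinZ Ebin_id.
    rewrite /cap -xcap /divergence /Phi /log_kernel -/q; ring.
  move=> k kn; rewrite /z ln_div ?posrE ?W0 ?q_gt0//.
  rewrite /binW !lnM ?posrE ?mulr_gt0 ?exprn_gt0 ?ltr0n ?bin_gt0//.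
  rewrite !lnXn// -[ln X *+ _]mulr_natr -[ln (1 - X) *+ _]mulr_natr natrB//; ring.
- by move=> i _; exact: binW_ge0.
- by rewrite -(Ebin1 n x) /Ebin; apply: eq_bigr => i _; rewrite mulr1.
- by move=> i; rewrite ltnS => ik; rewrite divr_gt0 ?W0 ?q_gt0.
Qed.

Let coef y := 'C(n, y)%:R * expR (Hbin n (y%:R / n%:R) - cap).

Let coef_ge0 y : 0 <= coef y.
Proof. by rewrite mulr_ge0 ?expR_ge0. Qed.

(** Inserting [kernel_ratio_ge] and taking logarithms reduces the interior case to d(x || X) <=
    d(y/n || X), which holds because x lies between X and y/n. *)
Lemma binW_le_kernel_ratio y x X : (y <= n)%N -> tight n P x -> 0 <= X <= 1 ->
  (X <= x <= y%:R / n%:R) || (y%:R / n%:R <= x <= X) ->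
  binW n y X <= coef y * kernel_ratio x X.
Proof.
move=> yn tx X01 ord; have [x01 xcap] := tx.
have n0 : 0 < n%:R :> R by rewrite ltr0n.
have rhs0 : 0 <= coef y * kernel_ratio x X by rewrite mulr_ge0 ?kernel_ratio_ge0.
have p01 := frac01 yn; set p := y%:R / n%:R in ord p01 *.
have [XE|XE|X01'] := itv01_cases X01.
(* At X = 0 only y = 0 has positive probability. The ordering then forces x = 0, where W_x is a
   point mass and tightness reads q(0) = exp(-cap). *)
- have [y0|y0] := posnP y; last first.
    by rewrite {1}XE /binW expr0n (gtn_eqF y0) mulr0 mul0r.
  have p0 : p = 0 by rewrite /p y0 mul0r.
  have x0 : x = 0.
    by move: ord; rewrite XE p0; case/orP => /andP[? ?]; apply/eqP; rewrite eq_le; apply/andP.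
  rewrite XE /coef -/p p0 Hbin0 /kernel_ratio x0 Ebin0 y0 bin0.
  have -> : expR (0 - cap) = q 0.
    have := xcap; rewrite x0 /divergence /Phi Hbin0 !Ebin0 bin0 ln1 -/cap -/(q 0) => <-.
    by rewrite !sub0r add0r sub0r opprK lnK// posrE q_gt0.
  by rewrite mul1r mulrCA divff ?mulr1// gt_eqF// q_gt0.
- have [yn'|yn'] := eqVneq y n; last first.
    have : (n - y != 0)%N by rewrite subn_eq0 -ltnNge ltn_neqAle yn' yn.
    by rewrite {1}XE /binW subrr expr0n => /negbTE->; rewrite mulr0.
  have p0 : p = 1 by rewrite /p yn' divff// gt_eqF.
  have x0 : x = 1.
    by move: ord; rewrite XE p0; case/orP => /andP[? ?]; apply/eqP; rewrite eq_le; apply/andP.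
  rewrite XE /coef -/p p0 Hbin1 /kernel_ratio x0 Ebin_at1 yn' binn.
  have -> : expR (0 - cap) = q n.
    have := xcap; rewrite x0 /divergence /Phi Hbin1 !Ebin_at1 binn ln1 -/cap -/(q n) => <-.
    by rewrite !sub0r add0r sub0r opprK lnK// posrE q_gt0.
  by rewrite mul1r mulrCA divff ?mulr1// gt_eqF// q_gt0.
have [X0 X1] : 0 < X /\ X < 1 by move/andP: X01'.
rewrite binW_exp// /coef -/p -mulrA ler_wpM2l//.
apply: le_trans (ler_wpM2l (expR_ge0 _) (kernel_ratio_ge tx X01')).
rewrite -expRD ler_expR /log_kernel.
have [x0|x0|xi] := itv01_cases x01.
- have px : p = x by case/orP: ord => /andP[? ?]; case/andP: p01 => ? ?; lra.
  by rewrite px; lra.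
- have px : p = x by case/orP: ord => /andP[? ?]; case/andP: p01 => ? ?; lra.
  by rewrite px; lra.
have [x0 x1] : 0 < x /\ x < 1 by move/andP: xi.
have := Hbin_tangent n xi p01.
(* After the tangent inequality at x, what remains is n (p - x) times the increase of the logit from
   X to x; both factors have the same sign. *)
suff : 0 <= n%:R * (p - x) * ((ln x - ln X) + (ln (1 - X) - ln (1 - x))) by lra.
rewrite -mulrA mulr_ge0//.
case/orP: ord => /andP[h1 h2].
  have a1 : ln X <= ln x by rewrite ler_ln ?posrE.
  have a2 : ln (1 - x) <= ln (1 - X) by rewrite ler_ln ?posrE//; lra.
  by rewrite mulr_ge0//; lra.
have a1 : ln x <= ln X by rewrite ler_ln ?posrE.
have a2 : ln (1 - X) <= ln (1 - x) by rewrite ler_ln ?posrE//; lra.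
by rewrite mulr_le0//; lra.
Qed.

Let kernel_ratioE x : kernel_ratio x = (fun X => \sum_(k < n.+1) binW n k x / q k * binW n k X).
Proof. by apply/funext => X; apply: eq_bigr => k _; rewrite [LHS]mulrA [LHS]mulrAC. Qed.

Let kernel_ratio_continuous x : continuous (kernel_ratio x).
Proof.
rewrite kernel_ratioE.
apply: (@big_sum_continuous _ _ (fun k X => binW n k x / q k * binW n k X)) => k X.
by apply: cvgM; [exact: cvg_cst|exact: binW_continuous].
Qed.

Lemma kernel_ratio_mean x : input_mean P (kernel_ratio x) = 1.
Proof.
rewrite kernel_ratioE.
rewrite (@mean_sum _ _ Lm _ (fun k X => binW n k x / q k * binW n k X)) => [|k X]; last first.
  by apply: cvgM; [exact: cvg_cst|exact: binW_continuous].
rewrite -(Ebin1 n x); apply: eq_bigr => k _.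
rewrite (meanZ Lm); last exact: binW_continuous.
by rewrite -out_pmfE -/(q k) divfK ?mulr1// gt_eqF// q_gt0// -ltnS.
Qed.

(* The hypothesis on D provides the tight point of D closest to y/n. *)
Let majorant y (D : set R) : (y <= n)%N -> closed D ->
  (forall A : set R, A !=set0 -> compact A -> A `<=` D ->
     exists2 x, A x & forall X, A X -> (X <= x <= y%:R / n%:R) || (y%:R / n%:R <= x <= X)) ->
  exists phi : R -> R, [/\ continuous phi, forall X, 0 <= X <= 1 -> 0 <= phi X,
    input_mean P phi <= coef y &
    forall X, tight n P X -> D X -> binW n y X <= phi X].
Proof.
move=> yn cD ext.
have cA : compact (tight n P `&` D).
  apply: subclosed_compact (@segment_compact R 0 1) _.
  - apply: closedI => //; exact: tight_closed.
  - by move=> x [[x01 _] _]; rewrite /= in_itv.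
have [A0|/nonemptyPn A0] := pselect ((tight n P `&` D) !=set0); last first.
  exists (fun=> 0); split => //.
  - exact: cst_continuous.
  - by rewrite (mean_cst Lm).
  - by move=> X tX DX; have : (tight n P `&` D) X by []; rewrite A0.
have [x [tx Dx] xmax] := ext _ A0 cA (@subIsetr _ _ _).
exists (fun X => coef y * kernel_ratio x X); split.
- by move=> X; apply: cvgM; [exact: cvg_cst|exact: kernel_ratio_continuous].
- by move=> X X01; rewrite mulr_ge0// kernel_ratio_ge0//; case: tx.
- by rewrite (meanZ Lm)// ?kernel_ratio_mean ?mulr1//; exact: kernel_ratio_continuous.
- move=> X tX DX; apply: binW_le_kernel_ratio => //; first by case: tX.
  exact: xmax.
Qed.

(** One majorant covers tight inputs X <= y/n and another X >= y/n, built at the last and first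
    tight point respectively. Each has mean at most [coef y], whence the factor 2. *)
Lemma out_pmf_le y : (y <= n)%N ->
  out_pmf n P y <= 2 * ('C(n, y)%:R * expR (Hbin n (y%:R / n%:R) - mutual_info n P)).
Proof.
move=> yn; rewrite -/cap -/(coef y).
have ci (A : set R) : {within A, continuous (@id R)}.
  by apply: continuous_subspaceT => x; exact: cvg_id.
have [f1 [c1 f1_ge0 m1 f1P]] : exists phi : R -> R, [/\ continuous phi, forall X, 0 <= X <= 1 -> 0 <= phi X,
    input_mean P phi <= coef y &
    forall X, tight n P X -> `]-oo, (y%:R / n%:R)]%classic X -> binW n y X <= phi X].
  apply: majorant => //.
  move=> A A0 cA sA; have [x Ax xmax] := compact_EVT_max A0 cA (ci A).
  rewrite inE in Ax; exists x => // X AX; apply/orP; left; apply/andP; split.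
    by apply: xmax; rewrite inE.
  by have := sA _ Ax; rewrite /= in_itv.
have [f2 [c2 f2_ge0 m2 f2P]] : exists phi : R -> R, [/\ continuous phi, forall X, 0 <= X <= 1 -> 0 <= phi X,
    input_mean P phi <= coef y &
    forall X, tight n P X -> `[(y%:R / n%:R), +oo[%classic X -> binW n y X <= phi X].
  apply: majorant => //; first exact: rray_closed.
  move=> A A0 cA sA; have [x Ax xmin] := compact_EVT_min A0 cA (ci A).
  rewrite inE in Ax; exists x => // X AX; apply/orP; right; apply/andP; split.
    by have := sA _ Ax; rewrite /= in_itv/= andbT.
  by apply: xmin; rewrite inE.
apply: le_trans (_ : input_mean P (fun X => f1 X + f2 X) <= _); last first.
  by rewrite (meanD Lm)//; lra.
rewrite out_pmfE; apply: (input_mean_le_tight capP).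
- exact: binW_continuous.
- by move=> X; apply: cvgD; [exact: c1|exact: c2].
move=> X tX; have X01 : 0 <= X <= 1 by case: tX.
have [h|h] := leP X (y%:R / n%:R).
  apply: le_trans (f1P _ tX _) _; first by rewrite /= in_itv.
  by rewrite lerDl f2_ge0.
apply: le_trans (f2P _ tX _) _; first by rewrite /= in_itv/= andbT ltW.
by rewrite lerDr f1_ge0.
Qed.

End output_bound.

(** * Comparison of the two output pmfs *)

Section comparison.
Variables (R : realType) (n : nat) (P : probability R R).
Hypothesis n_gt0 : (0 < n)%N.
Hypothesis capP : capacity_achieving n P.
Implicit Types (x t X : R) (y : nat).

Let iP : input_dist R P. Proof. by case: capP. Qed.
Let Lm := input_mean_is_mean iP.
Let Am := arcsine_is_mean R.
Let q y := out_pmf n P y.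
Let r y := Yref R n y.
Let cap := mutual_info n P.
Let q_gt0 y : (y <= n)%N -> 0 < q y. Proof. exact: out_pmf_gt0. Qed.
Let q_sum : \sum_(y < n.+1) q y = 1. Proof. exact: (mean_binW_sum Lm). Qed.
Let r_sum : \sum_(y < n.+1) r y = 1. Proof. exact: Yref_sum. Qed.
Let r_gt0 y : 0 < r y. Proof. exact: Yref_gt0. Qed.

Let lC y : R := ln 'C(n, y)%:R.
Let h y : R := Hbin n (y%:R / n%:R).
Let rho y := rstir R n y + rstir R n (n - y).

Let rho_bounds y : (y <= n)%N -> 0 <= rho y <= 1.
Proof.
move=> yn; have yn' : (n - y <= n)%N by exact: leq_subr.
have := rstir_le_half R yn; have := rstir_le_half R yn'.
have /andP[h1 _] := rstir_bounds R yn; have /andP[h2 _] := rstir_bounds R yn'.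
by rewrite /rho => a b; apply/andP; split; lra.
Qed.

Let ln_r y : (y <= n)%N -> ln (r y) = lC y + (h y - Astir R n - rho y).
Proof.
move=> yn; have C0 : 0 < 'C(n, y)%:R :> R by rewrite ltr0n bin_gt0.
have := ln_Yref R n_gt0 yn; rewrite -/(r y) ln_div ?posrE// -/(lC y) -/(h y) /rho; lra.
Qed.

Let sum_ln_r (p : nat -> R) : \sum_(y < n.+1) p y = 1 ->
  \sum_(y < n.+1) p y * ln (r y) = \sum_(y < n.+1) p y * lC y
    + \sum_(y < n.+1) p y * h y - Astir R n - \sum_(y < n.+1) p y * rho y.
Proof.
move=> p1; rewrite -[Astir R n]mul1r -p1 mulr_suml -big_split/= -!sumrB.
apply: eq_bigr => y _; have yn : (y <= n)%N by rewrite -ltnS.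
rewrite ln_r//; move: (lC y) (h y) (Astir R n) (rho y) (p y) => a b c d e; ring.
Qed.

Let arcsine_div : arcsine_mean (divergence n P) =
  \sum_(y < n.+1) r y * h y - arcsine_mean (@psi R n) + \sum_(y < n.+1) r y * lC y
   - \sum_(y < n.+1) r y * ln (q y).
Proof.
have AE (f : nat -> R) : arcsine_mean (fun x => Ebin n x f) = \sum_(y < n.+1) r y * f y.
  rewrite (mean_Ebin Am); apply: eq_bigr => y _.
  by rewrite arcsine_moment// -ltnS.
rewrite (meanB Am); [|exact: Phi_continuous|exact: Ebin_continuous].
rewrite (meanD Am); [|exact: Hbin_continuous|exact: Ebin_continuous].
rewrite (meanB Am); [|exact: Ebin_continuous|exact: Hbin_continuous].
by rewrite !AE; ring.
Qed.

Let arcsine_div_le : arcsine_mean (divergence n P) <= cap.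
Proof.
rewrite -[leRHS](mean_cst Am); apply: (mean_le Am).
- exact: divergence_continuous.
- exact: cst_continuous.
- by move=> x; exact: divergence_le.
Qed.

Let sum_r_rho_ge0 : 0 <= \sum_(y < n.+1) r y * rho y.
Proof.
apply: sumr_ge0 => y _; apply: mulr_ge0; first exact: ltW.
by have /andP[] : 0 <= rho y <= 1 by apply: rho_bounds; rewrite -ltnS.
Qed.

Let arcsine_psi_le1 : arcsine_mean (@psi R n) <= 1.
Proof.
rewrite -[leRHS](mean_cst Am); apply: (mean_le Am).
- exact: psi_continuous.
- exact: cst_continuous.
- by move=> x; exact: psi_le1.
Qed.

(** Gibbs' inequality replaces q by r in the arcsine average of [divergence]; inserting [sum_ln_r]
    leaves A minus the mean of [psi] plus that of [rho]. *)
Lemma capacity_ge : Astir R n - 1 <= cap.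
Proof.
have := arcsine_div_le; rewrite arcsine_div.
have : \sum_(y < n.+1) r y * ln (q y) <= \sum_(y < n.+1) r y * ln (r y).
  apply: gibbs_sum; [by move=> i _; exact: ltW| |exact: r_sum|exact: q_sum].
  by move=> i iq; apply: q_gt0.
rewrite (sum_ln_r r_sum).
have := arcsine_psi_le1; have := sum_r_rho_ge0; lra.
Qed.

(** The factor 2 comes from [out_pmf_le], one factor e from [capacity_ge] and the other from rho <=
    1. *)
Lemma out_pmf_le_Yref y : (y <= n)%N -> q y <= 2 * expR 1 ^+ 2 * r y.
Proof.
move=> yn; apply: le_trans (out_pmf_le n_gt0 capP yn) _.
rewrite -mulrA ler_wpM2l//.
have C0 : 0 < 'C(n, y)%:R :> R by rewrite ltr0n bin_gt0.
have -> : r y = 'C(n, y)%:R * expR (h y - Astir R n - rho y).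
  rewrite -[LHS]lnK ?posrE// ln_r// expRD /lC lnK//.
rewrite mulrCA ler_wpM2l ?(ltW C0)// expr2 -!expRD ler_expR.
have /andP[_ h1] := rho_bounds yn; have := capacity_ge; rewrite -/(h y) -/cap; lra.
Qed.

Let tau y : R := y.+1%:R^-1 + (n - y).+1%:R^-1.

Let rel_entropy_split : \sum_(y < n.+1) r y * ln (r y / q y) =
  \sum_(y < n.+1) r y * ln (r y) - \sum_(y < n.+1) r y * ln (q y).
Proof.
rewrite -sumrB; apply: eq_bigr => y _.
by rewrite ln_div ?posrE ?mulrBr// q_gt0// -ltnS.
Qed.

(** The arcsine average of [divergence] is at most cap, which bounds the r-sum of -ln q; Gibbs'
    inequality for q against r bounds cap. The terms [lC] and [Astir] cancel. *)
Let rel_entropy_le : \sum_(y < n.+1) r y * ln (r y / q y) <=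
  arcsine_mean (@psi R n) - input_mean P (@psi R n) + \sum_(y < n.+1) q y * rho y.
Proof.
have h1 := arcsine_div_le; rewrite arcsine_div in h1.
have capE : cap = input_mean P (@Hbin R n) + \sum_(y < n.+1) q y * lC y
    - \sum_(y < n.+1) q y * ln (q y).
  rewrite /cap -(divergence_mean capP).
  rewrite (meanB Lm); [|exact: Phi_continuous|exact: Ebin_continuous].
  rewrite (meanD Lm); [|exact: Hbin_continuous|exact: Ebin_continuous].
  by rewrite !(mean_Ebin Lm).
have psiE : input_mean P (@psi R n) = \sum_(y < n.+1) q y * h y - input_mean P (@Hbin R n).
  rewrite (meanB Lm); [|exact: Ebin_continuous|exact: Hbin_continuous].
  by rewrite (mean_Ebin Lm).
have h2 : \sum_(y < n.+1) q y * ln (r y) <= \sum_(y < n.+1) q y * ln (q y).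
  apply: gibbs_sum; [|by move=> i _|exact: q_sum|exact: r_sum].
  by move=> i iq; apply/ltW/q_gt0.
rewrite rel_entropy_split psiE (sum_ln_r r_sum); rewrite (sum_ln_r q_sum) in h2; rewrite capE in h1.
have := sum_r_rho_ge0; lra.
Qed.

Lemma rel_entropy_le2 : \sum_(y < n.+1) r y * ln (r y / q y) <= 2.
Proof.
apply: le_trans rel_entropy_le _.
have h1 : 0 <= input_mean P (@psi R n).
  rewrite -[leLHS](mean_cst Lm 0); apply: (mean_le Lm).
  - exact: cst_continuous.
  - exact: psi_continuous.
  - by move=> x; exact: psi_ge0.
have h2 : \sum_(y < n.+1) q y * rho y <= 1.
  rewrite -q_sum; apply: ler_sum => y _; have yn : (y <= n)%N by rewrite -ltnS.
  by rewrite ler_piMr ?(ltW (q_gt0 yn))//; case/andP: (rho_bounds yn).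
have := arcsine_psi_le1; lra.
Qed.

(** The leading halves of the two means of [psi] cancel. With 2 e^2 <= 18, the rest is at most 2 * 4
    + (2/3 + 1/2) * 18 * 4 = 92 times [wallis R n.+1]. *)
Lemma rel_entropy_le_wallis : expR 1 <= 3 :> R ->
  \sum_(y < n.+1) r y * ln (r y / q y) <= 92 * wallis R n.+1.
Proof.
move=> e3; apply: le_trans rel_entropy_le _.
have cT : continuous (@Tbin R n) by exact: Ebin_continuous.
have cZ (a b : R) : continuous (fun x => a + b * Tbin n x).
  by move=> x; apply: cvgD; [exact: cvg_cst|apply: cvgM; [exact: cvg_cst|exact: cT]].
have rtau : \sum_(y < n.+1) r y * tau y = 4 * wallis R n.+1.
  exact: (Yref_sum_inv2 _ (@Yref_sum R)).
have h1 : arcsine_mean (@psi R n) <= 2^-1 + 2 * (4 * wallis R n.+1).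
  apply: le_trans (_ : arcsine_mean (fun x => 2^-1 + 2 * Tbin n x) <= _).
    apply: (mean_le Am) => //; first exact: psi_continuous.
    by move=> x; exact: psi_le_half.
  rewrite (meanD Am) ?(mean_cst Am) ?(meanZ Am)//; last 2 first.
    exact: cst_continuous.
    by move=> x; apply: cvgM; [exact: cvg_cst|exact: cT].
  rewrite (mean_Ebin Am) -rtau lerD2l ler_wpM2l// le_eqVlt; apply/orP; left; apply/eqP.
  by apply: eq_bigr => y _; rewrite arcsine_moment// -ltnS.
set qtau := \sum_(y < n.+1) q y * tau y.
have h2 : 2^-1 - 2 / 3 * qtau <= input_mean P (@psi R n).
  apply: le_trans (_ : input_mean P (fun x => 2^-1 + (- (2 / 3)) * Tbin n x) <= _).
    rewrite (meanD Lm) ?(mean_cst Lm) ?(meanZ Lm)//; last 2 first.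
      exact: cst_continuous.
      by move=> x; apply: cvgM; [exact: cvg_cst|exact: cT].
    by rewrite (mean_Ebin Lm) mulNr.
  apply: (mean_le Lm) => //; first exact: psi_continuous.
  by move=> x x01; have := psi_ge_half n_gt0 x01; lra.
have h3 : \sum_(y < n.+1) q y * rho y <= 2^-1 * qtau.
  rewrite mulr_sumr; apply: ler_sum => y _; have yn : (y <= n)%N by rewrite -ltnS.
  rewrite mulrCA ler_wpM2l ?(ltW (q_gt0 yn))// /rho /tau mulrDr lerD// rstir_le_inv//.
  exact: leq_subr.
have h4 : qtau <= 18 * (4 * wallis R n.+1).
  rewrite -rtau mulr_sumr; apply: ler_sum => y _; have yn : (y <= n)%N by rewrite -ltnS.
  rewrite mulrA ler_wpM2r ?addr_ge0//.
  apply: le_trans (out_pmf_le_Yref yn) _; rewrite ler_wpM2r ?(ltW (r_gt0 _))//.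
  have : 0 <= expR 1 :> R by exact: expR_ge0.
  move: e3; move: (expR 1) => e; nra.
lra.
Qed.

End comparison.

(** * Numerical constants and conclusion *)

Section numeric.
Variable R : realType.

Lemma expR1_ge2 : 2 <= expR 1 :> R.
Proof. by have := expR_ge1Dx (1 : R); lra. Qed.

Lemma expR1_le3 : expR 1 <= 3 :> R.
Proof.
have h : 3^-1 <= expR (- 1) :> R.
  rewrite [leRHS](_ : _ = expR (- (8^-1)) ^+ 8); last first.
    by rewrite -expRM_natl; congr expR; field.
  apply: le_trans (_ : (7 / 8) ^+ 8 <= _); first by lra.
  by rewrite lerXn2r ?nnegrE ?expR_ge0//; have := expR_ge1Dx (- (8^-1) : R); lra.
by move: h; rewrite expRN lef_pV2 ?posrE ?expR_gt0.
Qed.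

(** The constants are 92^2 and 2 * 17^2. The proof squares exp(s/2) = exp 4 * exp(s/2 - 4), with exp
    4 >= 35 and a tangent bound on the second factor. *)
Lemma sq_le_expR (s : R) : 8 <= s -> 8464 * s ^+ 2 <= 578 * expR s.
Proof.
move=> s8.
have h4 : 35 <= expR 4 :> R.
  rewrite [leRHS](_ : _ = expR (4^-1) ^+ 16); last first.
    by rewrite -expRM_natl; congr expR; field.
  apply: le_trans (_ : (5 / 4) ^+ 16 <= _); first by lra.
  by rewrite lerXn2r ?nnegrE ?expR_ge0//; have := expR_ge1Dx (4^-1 : R); lra.
have h5 : 1 + (s / 2 - 4) <= expR (s / 2 - 4) by exact: expR_ge1Dx.
have -> : expR s = (expR 4 * expR (s / 2 - 4)) ^+ 2.
  by rewrite -expRD -expRM_natl; congr expR; field.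
set a := expR 4 in h4 *; set b := expR (s / 2 - 4) in h5 *.
have ab : 35 * (s / 2 - 3) <= a * b by rewrite ler_pM//; lra.
have : (35 * (s / 2 - 3)) ^+ 2 <= (a * b) ^+ 2.
  by rewrite lerXn2r ?nnegrE//; [lra|apply: le_trans ab; lra].
have c0 : (0 : R) <= 578 by exact: ler0n.
move/(ler_wpM2l c0); apply: le_trans.
nra.
Qed.

End numeric.

Theorem theorem3 (R : realType) (n : nat) (Pstar : probability R R) :
  (1 <= n)%N -> capacity_achieving n Pstar ->
  (forall y : nat, (y <= n)%N -> cstar R <= PYr (R:=R) n y / out_pmf n Pstar y) /\
  ((444 <= n)%N ->
     rel_entropy n (PYr (R:=R) n) (out_pmf n Pstar)
       <= 17 / ln (n%:R * pi / (2 * expR 1))).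
Proof.
move=> n_gt0 capP; have e2 := expR1_ge2 R; have e3 := expR1_le3 R.
have e0 : 0 < expR 1 :> R by exact: expR_gt0.
split=> [y yn|n444].
  have q0 := out_pmf_gt0 capP yn.
  have := out_pmf_le_Yref n_gt0 capP yn; rewrite PYrE ler_pdivlMr// => qr.
  (* It remains to see that 2 e^2 <= 4 e 3^(7/4) pi^(7/4); bounding the product of the two powers
     below by 3 is enough. *)
  have powR_ge (a : R) : 1 <= a -> a <= a `^ (7 / 4).
    move=> a1; rewrite -[leLHS]powRr1; last by rewrite (le_trans ler01).
    by rewrite ler_powR//; lra.
  have p33 : 3 <= 3 `^ (7 / 4) :> R by rewrite powR_ge// ler1n.
  have pp : 1 <= (pi : R) `^ (7 / 4).
    by have h := pi_ge2 R; apply: le_trans (powR_ge _ _); lra.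
  have r0 := Yref_gt0 R n y.
  rewrite /cstar mul1r ler_pdivrMl; last first.
    by rewrite !mulr_gt0// powR_gt0// pi_gt0.
  apply: le_trans qr _; rewrite ler_wpM2r ?(ltW r0)//.
  move: e2 e3 p33 pp; move: (expR 1) (3 `^ _) (pi `^ _) => e a b e2 e3 a3 b1.
  have : 3 <= a * b by nra.
  by rewrite -[_ * a * b]mulrA; move: (a * b) => c; nra.
have -> : rel_entropy n (PYr (R:=R) n) (out_pmf n Pstar) =
    \sum_(y < n.+1) Yref R n y * ln (Yref R n y / out_pmf n Pstar y).
  by apply: eq_bigr => y _; rewrite PYrE.
set m := n%:R * pi / (2 * expR 1); set s := ln m.
have n444' : 444 <= n%:R :> R by rewrite ler_nat.
have pi2 := pi_ge2 R; have pi4 : pi <= 4 :> R.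
  by have /andP[_] := @pihalf_02 R; lra.
have m1 : 1 < m by rewrite /m ltr_pdivlMr ?mulr_gt0//; nra.
have mn : m <= n%:R.
  rewrite /m ler_pdivrMr ?mulr_gt0// ler_wpM2l//; lra.
have s0 : 0 < s by rewrite /s ln_gt0.
have [s8|s8] := leP s 8.
  (* For s <= 8 the constant bound suffices, since 2 * 8 <= 17. *)
  apply: le_trans (rel_entropy_le2 n_gt0 capP) _.
  by rewrite ler_pdivlMr//; lra.
apply: le_trans (rel_entropy_le_wallis n_gt0 capP e3) _.
rewrite ler_pdivlMr//.
have w0 := wallis_gt0 R n.+1; have := wallis_sq_le R n.+1; set w := wallis R n.+1 in w0 *.
have mE : expR s = m by rewrite /s lnK// posrE (lt_trans ltr01).
have := sq_le_expR (ltW s8); rewrite mE => sm wn.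
(* As m <= n, this follows from [wallis_sq_le]. Combined with [sq_le_expR] and exp s = m it gives
   (92 w s)^2 <= 17^2. *)
have {}wn : w ^+ 2 * (2 * m) <= 1.
  apply: le_trans (_ : (2 * n.+1%:R + 1)^-1 * (2 * n.+1%:R + 1) <= _); last first.
    by rewrite mulVf// gt_eqF// ltr_wpDl.
  rewrite ler_pM ?sqr_ge0//; first by rewrite mulr_ge0// ltW// (lt_trans ltr01).
  by rewrite -natr1; lra.
rewrite -(@ler_pXn2r _ 2)// ?nnegrE ?mulr_ge0 ?ler0n ?(ltW w0) ?(ltW s0)//.
have w2 : 0 <= w ^+ 2 by exact: sqr_ge0.
have := ler_wpM2l w2 sm.
rewrite !exprMn; lra.
Qed.
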